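(* Let $f(\xi)=\sum_{i,j,k,\ell=1}^3 C_{ijk\ell}\,\xi_{ij}\xi_{k\ell}$, $\xi\in\mathbb R^{3\times 3}$, be a real quadratic form (with $C$ a real fourth-order tensor) that is quasiconvex. Let $T(y)$ be the $y$-matrix (acoustic tensor) of $f$. Assume that the polynomial $\det T(y)$ in $y\in\mathbb R^3$ is an extremal polynomial that is not a perfect square (i.e. not the square of a polynomial with real coefficients). Then $f$ is an extremal form.
   Context: All polynomials and forms have real coefficients. Quasiconvexity: a quadratic form $f$ on $\mathbb R^{3\times 3}$ is quasiconvex (for quadratic forms this is equivalent to rank-one convexity) if and only if $f(x\otimes y)\ge 0$ for all $x,y\in\mathbb R^3$, where $x\otimes y=(x_iy_j)_{i,j}$. This may be taken as the definition. One writes $f(x,y)$ for $f(x\otimes y)$. $y$-matrix (acoustic tensor): the unique symmetric $3\times 3$ matrix $T(y)$, whose entries are quadratic forms in $y$, such that $f(x\otimes y)=x\,T(y)\,x^T$ for all $x,y\in\mathbb R^3$ ($x$ a row vector). Rank-one form: the square $\big(\sum_{i,j}b_{ij}\xi_{ij}\big)^2$ of a (nonzero) linear form on $\mathbb R^{3\times 3}$. Extremal form: a quasiconvex quadratic form $f$ is extremal if one cannot subtract a rank-one form from it while preserving quasiconvexity, i.e. there is no nonzero matrix $B\in\mathbb R^{3\times 3}$ with $f(x\otimes y)-(xBy^T)^2\ge 0$ for all $x,y\in\mathbb R^3$. Extremal polynomial: a homogeneous polynomial $P$ of even degree $2m$ in $n$ variables is extremal if $P\ge 0$ on $\mathbb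 R^n$ and $P$ cannot be written as a sum of two nonnegative polynomials that are linearly independent. *)

(* Defs.v *)
From mathcomp Require Import all_boot all_order all_algebra.
From mathcomp Require Import reals.
From mathcomp Require Import ring lra.
From mathcomp Require Import mpoly.

Set Implicit Arguments.
Unset Strict Implicit.
Unset Printing Implicit Defensive.

Import Order.TTheory GRing.Theory Num.Theory.
Local Open Scope ring_scope.

Section QuadraticForms.
Variable R : realType.

(* Vectors of R^3 are row vectors, and a quadratic form on R^{3x3} is
   represented by the function 'M[R]_3 -> R that it induces. *)
Definition quad_form (C : 'I_3 -> 'I_3 -> 'I_3 -> 'I_3 -> R)
    (xi : 'M[R]_3) : R :=
  \sum_i \sum_j \sum_k \sum_l C i j k l * xi i j * xi k l.

Definition tens (x y : 'rV[R]_3) : 'M[R]_3 := \matrix_(i, j) (x 0 i * y 0 j).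

(* For quadratic forms, quasiconvexity is the same as rank-one convexity. *)
Definition quasiconvex (f : 'M[R]_3 -> R) : Prop :=
  forall x y : 'rV[R]_3, 0 <= f (tens x y).

Definition rank_one_form (B xi : 'M[R]_3) : R :=
  (\sum_i \sum_j B i j * xi i j) ^+ 2.

Definition extremal_form (f : 'M[R]_3 -> R) : Prop :=
  quasiconvex f /\
  ~ exists B : 'M[R]_3,
      B != 0 /\ quasiconvex (fun xi => f xi - rank_one_form B xi).

Definition is_y_matrix (f : 'M[R]_3 -> R) (T : 'M[{mpoly R[3]}]_3) : Prop :=
  [/\ T^T = T,
      forall i k, T i k \is 2.-homog
    & forall x y : 'rV[R]_3,
        f (tens x y) = (x *m map_mx (meval (y 0)) T *m x^T) 0 0].

End QuadraticForms.

Section ExtremalPolynomials.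
Variables (R : realType) (n : nat).
Implicit Types P Q : {mpoly R[n]}.

Definition nonneg_poly P : Prop := forall v : 'I_n -> R, 0 <= P.@[v].

Definition lin_indep P Q : Prop :=
  forall a b : R, a *: P + b *: Q = 0 -> a = 0 /\ b = 0.

Definition extremal_poly P : Prop :=
  [/\ exists m : nat, P \is (2 * m)%N.-homog,
      nonneg_poly P
    & ~ exists P1 P2 : {mpoly R[n]},
          [/\ nonneg_poly P1, nonneg_poly P2, P = P1 + P2 & lin_indep P1 P2]].

Definition perfect_square P : Prop := exists Q, P = Q ^+ 2.

End ExtremalPolynomials.

Lemma rank_one_form_tens (R : realType) (B : 'M[R]_3) (x y : 'rV[R]_3) :
  rank_one_form B (tens x y) = ((x *m B *m y^T) 0 0) ^+ 2.
Proof.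
rewrite /rank_one_form mxE; congr (_ ^+ 2); rewrite exchange_big /=.
apply: eq_bigr => j _; rewrite !mxE big_distrl /=; apply: eq_bigr => i _.
by rewrite !mxE mulrA [B i j * _]mulrC.
Qed.

Definition y_matrix (R : realType) (C : 'I_3 -> 'I_3 -> 'I_3 -> 'I_3 -> R) :
    'M[{mpoly R[3]}]_3 :=
  \matrix_(i, k) \sum_j \sum_l
    ((C i j k l + C k j i l) / 2%:R) *: ('X_j * 'X_l : {mpoly R[3]}).

Lemma y_matrixP (R : realType) (C : 'I_3 -> 'I_3 -> 'I_3 -> 'I_3 -> R) :
  is_y_matrix (quad_form C) (y_matrix C).
Proof.
split.
- apply/matrixP => i k; rewrite !mxE; apply: eq_bigr => j _.
  by apply: eq_bigr => l _; rewrite [C k _ _ _ + _]addrC.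
- move=> i k; rewrite mxE; apply: rpred_sum => j _; apply: rpred_sum => l _.
  by apply: rpredZ; rewrite -['X_j * 'X_l]mpolyXD dhomogX /= mdegD !mdeg1.
- move=> x y; rewrite /quad_form.
  pose S i k := \sum_j \sum_l C i j k l * (y 0 j * y 0 l).
  have -> : \sum_i \sum_j \sum_k \sum_l C i j k l * tens x y i j * tens x y k l
      = \sum_i \sum_k x 0 i * x 0 k * S i k.
    apply: eq_bigr => i _; rewrite exchange_big; apply: eq_bigr => k _.
    rewrite big_distrr; apply: eq_bigr => j _; rewrite big_distrr.
    by apply: eq_bigr => l _; rewrite !mxE /=; ring.
  have ev i k : map_mx (meval (y 0)) (y_matrix C) i k = (S i k + S k i) / 2%:R.
    rewrite !mxE raddf_sum -big_split big_distrl; apply: eq_bigr => j _ /=.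
    rewrite raddf_sum -big_split big_distrl; apply: eq_bigr => l _ /=.
    by rewrite mevalZ mevalM !mevalXU; field.
  have -> : (x *m map_mx (meval (y 0)) (y_matrix C) *m x^T) 0 0
      = \sum_i \sum_k x 0 i * x 0 k * ((S i k + S k i) / 2%:R).
    rewrite mxE exchange_big; apply: eq_bigr => k _.
    rewrite mxE big_distrl; apply: eq_bigr => i _ /=.
    by rewrite ev mxE; ring.
  have -> : \sum_i \sum_k x 0 i * x 0 k * ((S i k + S k i) / 2%:R) =
     (\sum_i \sum_k x 0 i * x 0 k * S i k +
      \sum_i \sum_k x 0 i * x 0 k * S k i) / 2%:R.
    rewrite -big_split big_distrl; apply: eq_bigr => i _ /=.
    by rewrite -big_split big_distrl; apply: eq_bigr => k _ /=; field.
  rewrite [X in _ + X]exchange_big /=.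
  have -> : \sum_j \sum_i x 0 i * x 0 j * S j i
      = \sum_i \sum_k x 0 i * x 0 k * S i k.
    by apply: eq_bigr => i _; apply: eq_bigr => k _; ring.
  by field.
Qed.

Lemma digits_inj (N n : nat) (a b : 'I_n -> nat) :
  (forall i, a i < N)%N -> (forall i, b i < N)%N ->
  (\sum_(i < n) a i * N ^ i = \sum_(i < n) b i * N ^ i)%N -> a =1 b.
Proof.
elim: n a b => [|n IH] a b aN bN; first by move=> _ [].
have step (c : 'I_n.+1 -> nat) : (\sum_(i < n.+1) c i * N ^ i =
    (\sum_(i < n) c (lift ord0 i) * N ^ i) * N + c ord0)%N.
  rewrite big_ord_recl expn0 muln1 addnC big_distrl; congr addn.
  by apply: eq_bigr => i _; rewrite /= /bump /= add1n expnS mulnCA mulnC mulnAC.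
have N0 : (0 < N)%N by apply: leq_trans (aN ord0).
rewrite !step => E.
have E0 : a ord0 = b ord0.
  have := congr1 (modn^~ N) E.
  by rewrite !modnMDl !modn_small.
move: E; rewrite E0 => /addIn /eqP; rewrite eqn_pmul2r // => /eqP /IH E.
move=> i; case: (unliftP ord0 i) => [j|] -> //.
by apply: E => k.
Qed.

(* Kronecker substitution v_i = t ^ (N ^ i). *)
Lemma meval_eq0 (R : realType) (n : nat) (p : {mpoly R[n]}) :
  (forall v, p.@[v] = 0) -> p = 0.
Proof.
move=> p0; pose N := msize p.
pose e (m : 'X_{1..n}) := (\sum_(i < n) m i * N ^ i)%N.
pose q : {poly R} := \sum_(m <- msupp p) p@_m *: 'X^(e m).
have ltN m (i : 'I_n) : m \in msupp p -> (m i < N)%N.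
  move/msize_mdeg_lt; apply: leq_ltn_trans.
  by rewrite mdegE (bigD1 i) //= leq_addr.
have qE t : q.[t] = 0.
  rewrite -[RHS](p0 (fun i => t ^+ (N ^ i))) mevalE /q.
  rewrite horner_sum; apply: eq_bigr => m _; rewrite hornerZ hornerXn.
  congr (_ * _); rewrite -prodrXr.
  by apply: eq_bigr => i _; rewrite -exprM mulnC.
have q0 : q = 0.
  apply/eqP/negP => /negP qn0.
  pose rs : seq R := [seq i%:R | i <- iota 0 (size q)].
  have urs : uniq rs.
    by rewrite map_inj_uniq ?iota_uniq // => i j /eqP; rewrite eqr_nat => /eqP.
  have ars : all (root q) rs by apply/allP => t _; rewrite /root qE.
  by have := max_poly_roots qn0 ars urs; rewrite size_map size_iota ltnn.
apply/mpolyP => m; rewrite mcoeff0.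
case: (boolP (m \in msupp p)) => [ms|/memN_msupp_eq0 //].
have := congr1 (fun r : {poly R} => r`_(e m)) q0; rewrite coef0 => <-.
rewrite coef_sum (bigD1_seq m) ?msupp_uniq //= coefZ coefXn eqxx mulr1.
rewrite big_seq_cond big1 ?addr0 // => m' /andP[ms' nm].
rewrite coefZ coefXn; case: eqP => [E|]; last by rewrite mulr0.
case/eqP: nm; apply/mnmP/(@digits_inj N) => [i|i|].
- exact: ltN.
- exact: ltN.
- exact/esym.
Qed.

Lemma sym_form_eq0 (R : realType) (M : 'M[R]_3) :
  M^T = M -> (forall x : 'rV[R]_3, (x *m M *m x^T) 0 0 = 0) -> M = 0.
Proof.
move=> sM M0; apply/matrixP => i k; rewrite [RHS]mxE.
have bil (a b : 'I_3) :
    ((delta_mx 0 a : 'rV[R]_3) *m M *m (delta_mx 0 b : 'rV[R]_3)^T) 0 0 = M a b.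
  by rewrite -rowE trmx_delta -colE !mxE.
have addE (A B : 'M[R]_1) : (A + B) 0 0 = A 0 0 + B 0 0 by rewrite !mxE.
have d a : M a a = 0 by rewrite -bil M0.
have Mki : M k i = M i k by rewrite -[in LHS]sM mxE.
have := M0 (delta_mx 0 i + delta_mx 0 k).
rewrite linearD /= !(mulmxDl, mulmxDr) !addE !bil !d Mki; lra.
Qed.

Lemma y_matrix_unique (R : realType) (f : 'M[R]_3 -> R) T1 T2 :
  is_y_matrix f T1 -> is_y_matrix f T2 -> T1 = T2.
Proof.
move=> [s1 _ e1] [s2 _ e2].
apply/matrixP => i k; apply/eqP; rewrite -subr_eq0; apply/eqP/meval_eq0 => v.
pose y : 'rV[R]_3 := \row_j v j.
have subE (A B : 'M[R]_1) : (A - B) 0 0 = A 0 0 - B 0 0 by rewrite !mxE.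
have M0 : map_mx (meval (y 0)) T1 - map_mx (meval (y 0)) T2 = 0.
  apply: sym_form_eq0 => [|x]; first by rewrite linearB /= !map_trmx s1 s2.
  by rewrite mulmxBr mulmxBl subE -e1 -e2 subrr.
have := congr1 (fun M : 'M[R]_3 => M i k) M0; rewrite !mxE => <-.
by rewrite mevalB; congr (_ - _); apply: meval_eq => j; rewrite mxE.
Qed.

(* Main.v *)
(* Suppose f(x,y) >= (x B y^T)^2 with B <> 0, and put b = B y, D = det T.  Then
   E = b^T adj(T) b satisfies 0 <= E <= D, so E = lam D by extremality, and
   lam <> 0 since otherwise adj(T) b = 0, hence D b = 0.  Thus S = lam T - b b^T
   is singular for every y, adj S has rank one, and b^T adj(S) b = lam^3 D; a
   diagonal entry p <> 0 of adj S gives p D = q^2 up to a constant, where p has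
   degree 4.  By unique factorization D = G H^2 with deg G <= 4.  A nonzero
   nonnegative ternary form of degree at most 4 dominates a nonzero square
   e r^2, e > 0 (following Choi and Lam's proof of Hilbert's theorem on ternary
   quartics).  So e (r H)^2 <= D, and extremality makes D a square. *)
Require Import Defs.
From mathcomp Require Import all_boot all_order all_algebra.
From mathcomp Require Import reals.
From mathcomp Require Import -(notations) mpoly.
From mathcomp Require Import boolp classical_sets functions topology normedtype.
From mathcomp Require Import derive.
From mathcomp Require Import ring lra zify.

Set Implicit Arguments.
Unset Strict Implicit.
Unset Printing Implicit Defensive.

Import Order.TTheory GRing.Theory Num.Theory.
Local Open Scope ring_scope.

(** * Factorization of bivariate polynomials *)

(** The obstacle is the degree 6: an extremal sextic that is not a square has no nonzero square
    below it, so nonnegativity of D alone yields nothing, and the factor G of degree at most 4 must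
    come from the extra relation p D = q^2. The relations behind it all follow from the determinant
    lemma det(A + t u u^T) = det A + t u^T adj(A) u. With A = T, u = b, t = -1 it gives D - E =
    det(T - b b^T) >= 0; with A = S, u = b, t = 1 it gives b^T adj(S) b = det(lam T) = lam^3 D,
    because det S = lam^2 (lam D - E) = 0. Some diagonal cofactor of S is nonzero, since otherwise
    adj(S) b = 0 and D = 0. The factorization takes place in R[s][t], after a change of coordinates
    that makes D(0,0,1) nonzero: then no degree in t is lost, and G and H can be homogenized to the
    right degrees. Forms are kept as functions, so that a linear substitution is a composition and a
    nonzero factor is cancelled by restriction to a line and density. *)

(* Descent on the size of p: the remainder r of a q modulo p has r^2 = p e with
   e smaller than p, and e d is again a square. *)
Lemma square_quotient_pseudo (A : idomainType) (p d q : {poly A}) :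
  p != 0 -> p * d = q ^+ 2 ->
  exists (a : A) (g h : {poly A}),
    [/\ a != 0, (size g <= size p)%N & a ^+ 2 *: d = g * h ^+ 2].
Proof.
have [n] := ubnP (size p); elim: n => // n IH in p q * => szp pn0 pdq.
set a := lead_coef p ^+ scalp q p; set c := q %/ p; set r := q %% p.
have an0 : a != 0 by rewrite expf_neq0 // lead_coef_eq0.
have rE : r = a *: q - c * p by rewrite (Pdiv.Idomain.divp_eq q p) addrC addKr.
have ltr : (size r < size p)%N by rewrite Pdiv.Idomain.ltn_modp.
(* Here [a q = c p]; squaring and cancelling one [p] gives [a^2 d = p c^2]. *)
have [r0|rn0] := eqVneq r 0.
  exists a, p, c; split=> //; apply: (mulfI pn0).
  move/eqP: r0; rewrite rE subr_eq0 => /eqP Eq.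
  by rewrite -scalerAr pdq -exprZn Eq; ring.
set e := a ^+ 2 *: d - (a *: (q * c)) *+ 2 + p * c ^+ 2.
have pe : p * e = r ^+ 2.
  by rewrite rE /e -!mul_polyC; move: pdq; rewrite !polyCM => pdq; ring: pdq.
have ed : e * d = (a *: d - c * q) ^+ 2.
  by rewrite /e -!mul_polyC; move: pdq; rewrite !polyCM => pdq; ring: pdq.
have en0 : e != 0.
  by apply: contra_neq rn0 => e0; apply/eqP; rewrite -sqrf_eq0 -pe e0 mulr0.
have lte : (size e < size p)%N.
  have : size (p * e) = size (r ^+ 2) by rewrite pe.
  rewrite size_mul // expr2 size_mul //.
  move: ltr pn0 en0 rn0; rewrite -!size_poly_gt0.
  move: (size p) (size e) (size r) => x y z; lia.
have [b [g [h [bn0 szg E]]]] := IH e _ (leq_trans lte szp) en0 ed.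
by exists b, g, h; split=> //; apply: leq_trans szg (ltnW lte).
Qed.

(** * Gauss's lemma and the clearing of denominators *)

Section Gauss.
Variable F : fieldType.
Implicit Types (pi a b : {poly F}) (g h d : {poly {poly F}}).

Lemma irreducible_factor a : (1 < size a)%N ->
  exists2 pi, irreducible_poly pi & pi %| a.
Proof.
have [n] := ubnP (size a); elim: n => // n IH in a * => sza a1.
have [[b [b1 bn ba]]|nb] :=
    pselect (exists b, [/\ size b != 1%N, ~~ (b %= a) & b %| a]).
  have an0 : a != 0 by rewrite -size_poly_gt0 ltnW.
  have bn0 : b != 0 by apply: contraNneq an0 => b0; move: ba; rewrite b0 dvd0p.
  have ltba : (size b < size a)%N.
    by rewrite ltn_neqAle dvdp_leq // andbT dvdp_size_eqp.
  have [|pi ? ?] := IH b (leq_trans ltba sza).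
    by rewrite ltn_neqAle eq_sym b1 size_poly_gt0.
  by exists pi => //; apply: dvdp_trans ba.
exists a => //; split=> // b b1 ba; apply/negPn/negP => bn.
by apply: nb; exists b.
Qed.

(** Divisibility of [g] by [pi] seen as a constant polynomial, that is, divisibility of the
    content. *)
Definition dvd_coefs pi g := forall i, pi %| g`_i.

Lemma dvd_coefsP pi g : dvd_coefs pi g -> exists g', g = pi *: g'.
Proof.
move=> pig; exists (\poly_(i < size g) (g`_i %/ pi)).
apply/polyP => i; rewrite coefZ coef_poly mulrC.
by case: ltnP => [_|szi]; [rewrite divpK | rewrite mul0r nth_default].
Qed.

(** Gauss's lemma. If [i] and [j] are the first indices where [pi] fails to divide a coefficient of
    [g] and of [h], then the coefficient of index [i + j] of the product is congruent to the product
    of these two coefficients modulo [pi]. *)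
Lemma dvd_coefsM pi g h : irreducible_poly pi ->
  dvd_coefs pi (g * h) -> dvd_coefs pi g \/ dvd_coefs pi h.
Proof.
move=> ipi pigh; apply: contrapT => /not_orP[ng nh].
have least (f : {poly {poly F}}) : ~ dvd_coefs pi f ->
    exists i, ~~ (pi %| f`_i) /\ forall j, (j < i)%N -> pi %| f`_j.
  move=> nf; have [i /negP ni] := (existsNP _).2 nf.
  have ex : exists i, ~~ (pi %| f`_i) by exists i.
  exists (ex_minn ex); case: ex_minnP => m nm minm; split=> // j ltjm.
  by apply/negPn/negP => nj; have := minm j nj; rewrite leqNgt ltjm.
have [i [ni li]] := least g ng; have [j [nj lj]] := least h nh.
have := pigh (i + j)%N; rewrite coefM.
have iP : (i < (i + j).+1)%N by lia.
rewrite (bigD1 (Ordinal iP)) //= addKn dvdp_addl; last first.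
  apply: (big_ind (fun x => pi %| x)) => [|x y|k /eqP kni]; [exact: dvdp0 | exact: dvdp_add |].
  have {}kni : (k : nat) <> i by move=> E; apply: kni; apply: val_inj.
  case: (ltnP k i) => ki; first by rewrite dvdp_mulr // li.
  by rewrite dvdp_mull // lj //; move: (ltn_ord k) kni ki; lia.
have cop : coprimep pi g`_i by rewrite irreducible_poly_coprime.
by rewrite Gauss_dvdpr // (negPf nj).
Qed.

(** Strips the multiplier [a^2] left by pseudo-division, one irreducible factor [pi] of [a] at a
    time. If [pi] divides [h], then [pi^2] cancels against [h^2]; otherwise both copies of [pi] come
    out of [g]. Neither operation increases the size of [g]. *)
Lemma square_quotient (p d q : {poly {poly F}}) : p != 0 -> p * d = q ^+ 2 ->
  exists g h : {poly {poly F}}, (size g <= size p)%N /\ d = g * h ^+ 2.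
Proof.
move=> pn0 /(square_quotient_pseudo pn0) [a [g [h [an0 szg]]]].
move: szg; move: (size p) => N {p q pn0}.
have [n] := ubnP (size a); elim: n => // n IH in a g h an0 * => sza szg E.
have [a1|] := leqP (size a) 1.
  have [c aE] : exists c, a = c%:P by exists a`_0; rewrite -size1_polyC.
  have cn0 : c != 0 by rewrite -polyC_eq0 -aE.
  exists ((c ^- 2)%:P *: g), h; split; first by rewrite (leq_trans (size_scale_leq _ _)).
  by rewrite -scalerAl -E scalerA aE -rmorphXn -rmorphM /= mulVf ?expf_neq0 ?scale1r.
move=> a1; have [pi ipi pia] := irreducible_factor a1.
have pn0 : pi != 0 := irredp_neq0 ipi.
have pZI : injective ( *:%R pi : {poly {poly F}} -> _).
  by move=> x y; rewrite -!mul_polyC => /mulfI; apply; rewrite polyC_eq0.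
have /dvdpP[b aE] := pia.
have bn0 : b != 0 by apply: contra_neq an0 => b0; rewrite aE b0 mul0r.
have szb : (size b < n)%N.
  move: sza; rewrite aE size_mul //; case: ipi => + _.
  by move: bn0; rewrite -size_poly_gt0; move: (size b) (size pi) => x y; lia.
have step g' h' : (size g' <= N)%N -> b ^+ 2 *: d = g' * h' ^+ 2 ->
    exists g h : {poly {poly F}}, (size g <= N)%N /\ d = g * h ^+ 2.
  by move=> s' E'; apply: (IH b g' h').
have onh g' h' : (size g' <= N)%N -> dvd_coefs pi h' ->
    (pi * b) ^+ 2 *: d = g' * h' ^+ 2 ->
    exists g h : {poly {poly F}}, (size g <= N)%N /\ d = g * h ^+ 2.
  move=> s' /dvd_coefsP[h'' ->] E'; apply: (step g' h'' s'); apply/pZI/pZI.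
  by rewrite !scalerA; move: E'; rewrite -!mul_polyC !rmorphM /= => E'; ring: E'.
have {}E : (pi * b) ^+ 2 *: d = g * h ^+ 2 by rewrite -E aE mulrC.
have E0 := E.
have : dvd_coefs pi (g * h ^+ 2).
  by move=> i; rewrite -E coefZ exprMn -mulrA expr2 -mulrA dvdp_mulr.
case/(dvd_coefsM ipi) => [/dvd_coefsP[g' gE]|]; last first.
  rewrite expr2 => pih.
  by apply: (onh g h szg) E; case: (dvd_coefsM ipi pih).
have szg' : (size g' <= N)%N.
  by move: szg; rewrite gE -mul_polyC size_Cmul.
have {}E : pi *: (b ^+ 2 *: d) = g' * h ^+ 2.
  apply: pZI; move: E; rewrite gE -!mul_polyC !rmorphXn !rmorphM /= => E.
  by ring: E.
have : dvd_coefs pi (g' * h ^+ 2) by move=> i; rewrite -E coefZ dvdp_mulr.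
case/(dvd_coefsM ipi) => [/dvd_coefsP[g'' g'E]|].
  apply: (step g'' h); first by move: szg'; rewrite g'E -mul_polyC size_Cmul.
  by apply: pZI; rewrite E g'E scalerAl.
rewrite expr2 => pih; apply: (onh g h) => //.
  by case: (dvd_coefsM ipi pih).
Qed.

End Gauss.

(** * Forms as functions on row vectors *)

Section Univariate.
Variable R : realType.
Implicit Types p q : {poly R}.

Lemma poly_nonroot p q : p != 0 -> forall e : R, 0 < e ->
  exists2 t, 0 < t < e & ~~ root p t.
Proof.
move=> pn0 e e0; apply: contrapT => H.
(* The points e/2, e/3, ... lie in the open interval; [size p] of them are one more than the degree
   of [p]. *)
pose rs : seq R := [seq e / i.+2%:R | i <- iota 0 (size p)].
have urs : uniq rs.
  rewrite map_inj_uniq ?iota_uniq // => i j /(mulfI (lt0r_neq0 e0)) /invr_inj /eqP.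
  by rewrite eqr_nat => /eqP [].
have ars : all (root p) rs.
  apply/allP => t /mapP[i _ ->]; apply/negPn/negP => nr; apply: H.
  exists (e / i.+2%:R) => //; rewrite divr_gt0 ?ltr0n //=.
  by rewrite ltr_pdivrMr ?ltr0n // ltr_pMr // ltr1n.
by have := max_poly_roots pn0 ars urs; rewrite size_map size_iota ltnn.
Qed.

(** If [p] were negative at 0, it would be negative on a whole interval to the right of 0, and [q]
    has a nonroot there. The interval is explicit: [p(t) = p(0) + t r(t)], with [r] bounded on (0,
    1) by the sum [M] of the absolute values of its coefficients. *)
Lemma poly_ge0_dense p q : q != 0 ->
  (forall t, ~~ root q t -> 0 <= p.[t]) -> 0 <= p.[0].
Proof.
move=> qn0 H; rewrite leNgt; apply/negP => p0.
have /factor_theorem[r rE] : root (p - p.[0]%:P) 0.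
  by rewrite /root !hornerE subrr.
have pE t : p.[t] = p.[0] + r.[t] * t.
  have := congr1 (horner^~ t) rE; rewrite !hornerE subr0; lra.
pose M := \sum_(i < size r) `|r`_i|.
have M0 : 0 <= M by apply: sumr_ge0.
have rM t : 0 < t < 1 -> r.[t] <= M.
  case/andP=> t0 t1; rewrite horner_coef; apply: ler_sum => i _.
  apply: le_trans (ler_norm _) _; rewrite normrM ler_piMr // normrX.
  by rewrite exprn_ile1 ?normr_ge0 // gtr0_norm // ltW.
pose e := Num.min 1 (- p.[0] / (M + 1)).
have e0 : 0 < e by rewrite lt_min ltr01 divr_gt0 //; lra.
have [t /andP[t0 te] nr] := poly_nonroot p qn0 e0.
have := H _ nr; rewrite pE.
move: te; rewrite lt_min => /andP[t1]; rewrite ltr_pdivlMr; last lra.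
have := rM t; rewrite t0 t1 => /(_ isT); nra.
Qed.

End Univariate.

Section Forms.
Variables (R : realType) (m : nat).
Implicit Types (F G : 'rV[R]_m -> R) (v w : 'rV[R]_m).

(** Homogeneous polynomials of degree [n], as functions, by splitting off one variable per level.
    The decomposition is not unique, but closure properties become short inductions; [form_mpoly]
    and [mpoly_form] translate to and from formal polynomials. *)
Fixpoint is_form n F : Prop :=
  if n is n'.+1 then
    exists G : 'I_m -> 'rV[R]_m -> R,
      (forall i, is_form n' (G i)) /\ forall v, F v = \sum_i v 0 i * G i v
  else exists c, forall v, F v = c.

Lemma eq_form n F G : F =1 G -> is_form n F -> is_form n G.
Proof. by move=> /funext ->. Qed.

Lemma form_const c : is_form 0 (fun=> c). Proof. by exists c. Qed.

Lemma form0 n : is_form n (fun=> 0).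
Proof.
elim: n => [|n IH]; first exact: form_const.
by exists (fun _ _ => 0); split=> // v; rewrite big1 // => i _; rewrite mulr0.
Qed.

Lemma formD n F G : is_form n F -> is_form n G -> is_form n (fun v => F v + G v).
Proof.
elim: n F G => [|n IH] F G; first by case=> a FE [b GE]; exists (a + b) => v; rewrite FE GE.
case=> A [hA FE] [B [hB GE]]; exists (fun i v => A i v + B i v); split=> [i|v].
  exact: (IH _ _ (hA i) (hB i)).
by rewrite FE GE -big_split; apply: eq_bigr => i _; rewrite mulrDr.
Qed.

Lemma form_sum n (I : Type) (r : seq I) (F : I -> 'rV[R]_m -> R) :
  (forall i, is_form n (F i)) -> is_form n (fun v => \sum_(i <- r) F i v).
Proof.
move=> hF; elim: r => [|i r IH].
  by apply: (eq_form _ (form0 n)) => v; rewrite big_nil.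
by apply: (eq_form _ (formD (hF i) IH)) => v; rewrite big_cons.
Qed.

Lemma formM n k F G : is_form n F -> is_form k G -> is_form (n + k) (fun v => F v * G v).
Proof.
elim: n F => [|n IH] F.
  case=> c FE; rewrite add0n => hG.
  rewrite (_ : (fun v => _) = (fun v => c * G v)); last first.
    by apply: funext => v; rewrite FE.
  move: hG; clear.
  elim: k G => [|k IH] G; first by case=> d GE; exists (c * d) => v; rewrite GE.
  case=> B [hB GE]; exists (fun i v => c * B i v); split=> [i|v]; first exact: (IH _ (hB i)).
  by rewrite GE mulr_sumr; apply: eq_bigr => i _; rewrite mulrCA.
case=> A [hA FE] hG; exists (fun i v => A i v * G v); split=> [i|v]; first exact: (IH _ (hA i)).
by rewrite FE mulr_suml; apply: eq_bigr => i _; rewrite mulrA.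
Qed.

Lemma formZ n c F : is_form n F -> is_form n (fun v => c * F v).
Proof. exact: (formM (form_const c)). Qed.

Lemma formB n F G : is_form n F -> is_form n G -> is_form n (fun v => F v - G v).
Proof.
move=> hF hG; apply: (eq_form _ (formD hF (formZ (-1) hG))) => v.
by rewrite mulN1r.
Qed.

Lemma formX n k F : is_form n F -> is_form (k * n) (fun v => F v ^+ k).
Proof.
move=> hF; elim: k => [|k IH]; first by apply: eq_form (form_const 1).
by rewrite mulSn; apply: eq_form (formM hF IH) => v; rewrite exprS.
Qed.

Lemma form_coord i : is_form 1 (fun v => v 0 i).
Proof.
exists (fun j _ => (j == i)%:R); split=> [j|v]; first exact: form_const.
by rewrite (bigD1 i) //= eqxx mulr1 big1 ?addr0 // => j /negPf ->; rewrite mulr0.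
Qed.

Lemma form_homog n F : is_form n F -> forall c v, F (c *: v) = c ^+ n * F v.
Proof.
elim: n F => [|n IH] F; first by case=> a FE c v; rewrite !FE mul1r.
case=> A [hA FE] c v; rewrite !FE mulr_sumr; apply: eq_bigr => i _.
by rewrite mxE (IH _ (hA i)) mulrACA -exprS.
Qed.

Lemma form_line n F : is_form n F -> forall v w,
  exists p : {poly R}, forall t, F (v + t *: w) = p.[t].
Proof.
elim: n F => [|n IH] F; first by case=> a FE v w; exists a%:P => t; rewrite FE hornerC.
case=> A [hA FE] v w.
have [p pE] := choice (fun i => IH _ (hA i) v w).
exists (\sum_i ((v 0 i)%:P + (w 0 i) *: 'X) * p i) => t.
rewrite FE horner_sum; apply: eq_bigr => i _; rewrite pE !hornerE.
by rewrite !mxE; ring.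
Qed.

(** On the line from [v] to a point [w] with [G w != 0], the restriction of [G] is a nonzero
    polynomial, so the univariate case applies at parameter 0. This is the tool for cancelling a
    factor that may vanish somewhere. *)
Lemma form_ge0_dense n k F G : is_form n F -> is_form k G -> (exists w, G w != 0) ->
  (forall v, G v != 0 -> 0 <= F v) -> forall v, 0 <= F v.
Proof.
move=> hF hG [w Gw] H v.
have [p pE] := form_line hF v (w - v); have [q qE] := form_line hG v (w - v).
have := pE 0; rewrite scale0r addr0 => ->; apply: (@poly_ge0_dense _ _ q).
  apply: contraNneq Gw => q0; have := qE 1.
  by rewrite q0 horner0 scale1r addrCA subrr addr0 => ->.
by move=> t; rewrite /root -qE -pE; apply: H.
Qed.

Lemma form_eq_dense n k F H G : is_form n F -> is_form n H -> is_form k G ->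
  (exists w, G w != 0) -> (forall v, G v != 0 -> F v = H v) -> F =1 H.
Proof.
move=> hF hH hG nG E v; apply/eqP; rewrite eq_le.
apply/andP; split; rewrite -subr_ge0.
  apply: (form_ge0_dense (formB hH hF) hG nG) => u Gu.
  by rewrite E // subrr.
apply: (form_ge0_dense (formB hF hH) hG nG) => u Gu.
by rewrite E // subrr.
Qed.

Lemma form_mpoly n F : is_form n F ->
  exists P : mpoly m R, forall v, meval (v 0) P = F v.
Proof.
elim: n F => [|n IH] F; first by case=> a FE; exists (mpolyC m a) => v; rewrite mevalC FE.
case=> A [hA FE]; have [P PE] := choice (fun i => IH _ (hA i)).
exists (\sum_i mpolyX _ (mnm1 i) * P i) => v.
rewrite FE raddf_sum; apply: eq_bigr => i _.
by rewrite /= mevalM mevalXU PE.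
Qed.

Lemma form_prod (I : Type) (r : seq I) (d : I -> nat)
    (F : I -> 'rV[R]_m -> R) : (forall i, is_form (d i) (F i)) ->
  is_form (\sum_(i <- r) d i) (fun v => \prod_(i <- r) F i v).
Proof.
move=> hF; elim: r => [|i r IH].
  by rewrite big_nil; apply: eq_form (form_const 1) => v; rewrite big_nil.
by rewrite big_cons; apply: eq_form (formM (hF i) IH) => v; rewrite big_cons.
Qed.

Lemma mpoly_form n (P : mpoly m R) :
  P \is ishomog1 n mdeg -> is_form n (fun v => meval (v 0) P).
Proof.
move=> /dhomogP hP.
pose M (k : multinom m) (v : 'rV[R]_m) : R :=
  if k \in msupp P then mcoeff k P * \prod_i v 0 i ^+ k i else 0.
apply: (@eq_form _ (fun v => \sum_(k <- msupp P) M k v)) => [v|].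
  by rewrite mevalE big_seq [RHS]big_seq; apply: eq_bigr => k kP; rewrite /M kP.
apply: form_sum => k; rewrite /M; case: (boolP (k \in msupp P)) => [kP|_]; last exact: form0.
have -> : n = (\sum_i k i)%N by rewrite -(hP k kP) /= mdegE.
apply: formZ; apply: (@form_prod _ _ k) => i.
by have := formX (k i) (form_coord i); rewrite muln1.
Qed.

(** * Continuity of forms and compactness of the sphere *)

Import numFieldNormedType.Exports.
Local Open Scope classical_set_scope.

Lemma form_continuous n F : is_form n F -> continuous F.
Proof.
elim: n F => [|n IH] F.
  by case=> a FE; rewrite (_ : F = fun=> a); [exact: cst_continuous | exact: funext].
case=> A [hA FE]; rewrite (_ : F = (fun v => \sum_i v 0 i * A i v)); last exact: funext.
move=> v; apply: (@cvg_big _ _ _ _ _ add_continuous _ _ _ _ _ (nbhs_filter v)) => i _.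
by apply: cvgM; [exact: coord_continuous | exact: (IH _ (hA i))].
Qed.

(** On the compact unit sphere [F] has a positive minimum and [G] a maximum; equal degrees carry the
    comparison to all vectors. Positive degree makes both forms vanish at 0. *)
Lemma form_pos_bound n F G : (0 < n)%N -> is_form n F -> is_form n G ->
  (forall v, v != 0 -> 0 < F v) -> exists2 e, 0 < e & forall v, e * G v <= F v.
Proof.
move=> n0 hF hG Fpos.
have F0 (H : 'rV[R]_m -> R) : is_form n H -> H 0 = 0.
  move=> hH; have := form_homog hH 0 0.
  by rewrite scale0r expr0n eqn0Ngt n0 /= mul0r.
case: (pselect (exists v : 'rV[R]_m, v != 0)) => [[w wn0]|no]; last first.
  exists 1 => // v; have -> : v = 0.
    by apply: contrapT => /eqP vn0; apply: no; exists v.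
  by rewrite !F0 // mulr0.
pose S := [set v : 'rV[R]_m | `|v| = 1].
have unit v : v != 0 -> S (`|v|^-1 *: v).
  by move=> vn0; rewrite /S /= normrZ normfV normr_id mulVf // normr_eq0.
have cS : compact S.
  apply: bounded_closed_compact.
    exists 1; split; [exact: num_real|] => x x1 v /=.
    by rewrite /S /= => ->; exact: ltW.
  apply: (@preimage_closed _ _ (fun v : 'rV[R]_m => `|v|) [set 1]).
    by move=> v _; exact: norm_continuous.
  exact: closed_eq.
have S0 : S !=set0 by exists (`|w|^-1 *: w); exact: unit.
have cont H : is_form n H -> {within S, continuous H}.
  by move=> hH; apply: continuous_subspaceT; exact: form_continuous hH.
have [c cS' cmin] := compact_EVT_min S0 cS (cont _ hF).
have [d _ dmax] := compact_EVT_max S0 cS (cont _ hG).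
have Fc : 0 < F c.
  apply: Fpos; apply/eqP => c0; move: cS'.
  by rewrite c0 inE /S /= normr0 => /eqP; rewrite eq_sym oner_eq0.
(* The absolute value and the added 1 keep the denominator positive even if the maximum of [G] is
   zero or negative. *)
exists (F c / (`|G d| + 1)) => [|v]; first by rewrite divr_gt0 // ltr_wpDl.
have [->|vn0] := eqVneq v 0; first by rewrite !F0 // mulr0.
have vE : v = `|v| *: (`|v|^-1 *: v).
  by rewrite scalerA divff ?scale1r // normr_eq0.
have : `|v|^-1 *: v \in S by rewrite inE; exact: unit.
move: vE; move: (`|v|^-1 *: v) => u vE uS.
rewrite vE (form_homog hF) (form_homog hG) mulrCA ler_wpM2l ?exprn_ge0 //.
apply: le_trans (cmin _ uS).
have dp : 0 < `|G d| + 1 by rewrite ltr_wpDl.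
rewrite mulrAC ler_pdivrMr // ler_pM2l //.
by apply: le_trans (dmax _ uS) _; apply: le_trans (ler_norm _) _; rewrite lerDl.
Qed.

End Forms.

(** * Dehomogenization *)

Lemma form_mulmx (R : realType) (m k n : nat) (M : 'M[R]_(k, m))
    (F : 'rV[R]_m -> R) :
  is_form n F -> is_form n (fun v => F (v *m M)).
Proof.
elim: n F => [|n IH] F; first by case=> c FE; exists c => v.
case=> A [hA FE].
rewrite (_ : (fun v => _) = (fun v => \sum_i (v *m M) 0 i * A i (v *m M))).
  apply: form_sum => i; apply: (@formM _ _ 1); last exact: (IH _ (hA i)).
  apply: (@eq_form _ _ _ (fun v : 'rV_k => \sum_j M j i * v 0 j)) => [v|].
    by rewrite mxE; apply: eq_bigr => j _; rewrite mulrC.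
  by apply: form_sum => j; apply: formZ; exact: form_coord.
exact: funext.
Qed.

(** * Total degree of bivariate polynomials *)

Section TotalDegree.
Variable F : fieldType.
Implicit Types (f g h d : {poly {poly F}}) (n : nat).

Definition tdeg_le n f := forall i j, (n < i + j)%N -> f`_i`_j = 0.

(* The substitution t := s t turns the total degree into the degree in s. *)
Definition tdeg_sub f : {poly {poly F}} :=
  (map_poly (map_poly polyC) f).['X * 'X%:P].

Lemma tdeg_subM f g : tdeg_sub (f * g) = tdeg_sub f * tdeg_sub g.
Proof. by rewrite /tdeg_sub rmorphM hornerM. Qed.

(** With t the outer variable of [f] and s the inner one, t^i s^j becomes s^(i+j) t^i, so distinct
    monomials stay distinct and [j] is recovered as [k - i]. *)
Lemma coef_tdeg_sub f k i :
  (tdeg_sub f)`_k`_i = if (i <= k)%N then f`_i`_(k - i) else 0.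
Proof.
rewrite /tdeg_sub horner_coef !coef_sum.
have szf : (size (map_poly (map_poly polyC) f) <= size f)%N by exact: size_poly.
rewrite (eq_bigr (fun j : 'I_(size _) =>
  if (j == i :> nat) && (i <= k)%N then f`_i`_(k - i) else 0)); last first.
  move=> j _; rewrite coef_map /= exprMn -rmorphXn /= mulrA coefMC coefMXn.
  case: ltnP => [ij|ji]; first by rewrite gtn_eqF.
  rewrite coefMXn coef_map /=; case: ltnP => [kj|jk].
    by rewrite coef0; case: eqP => [<-|//]; rewrite leqNgt kj.
  rewrite coefC subn_eq0 [in RHS]eqn_leq ji andTb.
  by case: leqP => // ij; rewrite (_ : i = j) ?jk //; apply/eqP; rewrite eqn_leq ij.
case: (leqP i k) => ik; last by rewrite big1 // => j _; rewrite andbF.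
case: (ltnP i (size (map_poly (map_poly polyC) f))) => szi.
  rewrite (bigD1 (Ordinal szi)) //= eqxx /= big1 ?addr0 // => j.
  by rewrite -val_eqE /= => /negPf ->.
have -> : f`_i = 0.
  have := nth_default 0 szi; rewrite coef_map /= => /eqP.
  by rewrite map_polyC_eq0 => /eqP.
rewrite coef0 big1 // => j _; by case: eqP.
Qed.

Lemma tdeg_leE n f : tdeg_le n f <-> (size (tdeg_sub f) <= n.+1)%N.
Proof.
split=> [tf|/leq_sizeP szf i j nij].
  apply/leq_sizeP => k nk; apply/polyP => i; rewrite coef_tdeg_sub coef0.
  by case: leqP => // ik; apply: tf; rewrite subnKC.
by have := coef_tdeg_sub f (i + j) i; rewrite leq_addr addKn szf // coef0.
Qed.

Lemma tdeg_le_size n f : tdeg_le n f -> (size f <= n.+1)%N.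
Proof.
move=> tf; apply/leq_sizeP => i ni; apply/polyP => j; rewrite coef0.
by apply: tf; apply: leq_trans ni (leq_addr _ _).
Qed.

(** Degrees in t and total degrees both add over products. As [d] has degree 6 in t and total degree
    at most 6, 6 = deg_t g + 2 deg_t h <= tdeg g + 2 tdeg h <= 6. Hence equality holds throughout:
    the total degree of [g] equals its degree in t, so it is at most 4, and it is even. *)
Lemma sextic_split d g h : tdeg_le 6 d -> d`_6 != 0 -> (size g <= 5)%N ->
  d = g * h ^+ 2 -> exists m, [/\ (m <= 2)%N, tdeg_le m.*2 g & tdeg_le (3 - m) h].
Proof.
move=> td d6 szg dE.
have szd : size d = 7%N.
  apply/eqP; rewrite eqn_leq (tdeg_le_size td) /=.
  by rewrite ltnNge; apply/negP => /leq_sizeP /(_ 6%N (leqnn _)) /eqP; apply/negP.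
have dn0 : d != 0 by rewrite -size_poly_gt0 szd.
have gn0 : g != 0 by apply: contra_neq dn0; rewrite dE => ->; rewrite mul0r.
have hn0 : h != 0 by apply: contra_neq dn0; rewrite dE => ->; rewrite expr0n mulr0.
have sub0 f : f != 0 -> tdeg_sub f != 0.
  apply: contra_neq => f0; apply/polyP => i; apply/polyP => j.
  by have := coef_tdeg_sub f (i + j) i; rewrite f0 leq_addr addKn !coef0.
have := szd; rewrite dE size_mul ?expf_neq0 // expr2 size_mul //.
have := (tdeg_leE 6 d).1 td; rewrite dE tdeg_subM expr2 tdeg_subM.
rewrite size_mul ?mulf_neq0 ?sub0 // size_mul ?sub0 //.
have := tdeg_le_size ((tdeg_leE (size (tdeg_sub h)).-1 h).2 (leqSpred _)).
have := sub0 _ gn0; have := sub0 _ hn0; move: gn0 hn0.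
rewrite -!size_poly_gt0 => g0 h0 h1 g1 H1 H2 H3.
(* The size is the total degree plus one; since that degree is even, halving rounds the extra one
   away. *)
exists ((size (tdeg_sub g))./2); split; last 2 first.
- apply/tdeg_leE; move: (size (tdeg_sub g)) => x; lia.
- apply/tdeg_leE; move: g0 h0 h1 g1 H1 H2 H3 szg.
  move: (size (tdeg_sub g)) (size (tdeg_sub h)) (size g) (size h) => x y z w.
  lia.
move: g0 h0 h1 g1 H1 H2 H3 szg.
move: (size (tdeg_sub g)) (size (tdeg_sub h)) (size g) (size h) => x y z w.
lia.
Qed.

End TotalDegree.

Section Dehomogenization.
Variable R : realType.
Implicit Types (F G : 'rV[R]_3 -> R) (x y z s t : R).

Definition row3 x y z : 'rV[R]_3 := \row_(i < 3) [:: x; y; z]`_i.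

Lemma row3_0 x y z : row3 x y z 0 0 = x. Proof. by rewrite mxE. Qed.
Lemma row3_1 x y z : row3 x y z 0 1 = y. Proof. by rewrite mxE. Qed.
Lemma row3_2 x y z : row3 x y z 0 2 = z. Proof. by rewrite mxE. Qed.
Definition row3E := (row3_0, row3_1, row3_2).

Lemma ord3P (P : 'I_3 -> Prop) : P 0 -> P 1 -> P 2 -> forall i, P i.
Proof.
move=> P0 P1 P2 [[|[|[|//]]] lti].
- by rewrite (_ : Ordinal _ = 0) //; apply: val_inj.
- by rewrite (_ : Ordinal _ = 1) //; apply: val_inj.
- by rewrite (_ : Ordinal _ = 2) //; apply: val_inj.
Qed.

Lemma row3_eta (v : 'rV[R]_3) : v = row3 (v 0 0) (v 0 1) (v 0 2).
Proof. by apply/rowP; apply: ord3P; rewrite row3E. Qed.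

Lemma sum3 (V : nmodType) (f : 'I_3 -> V) : \sum_i f i = f 0 + f 1 + f 2.
Proof.
rewrite !big_ord_recl big_ord0 addr0 addrA.
by congr (f _ + f _ + f _); apply: val_inj.
Qed.

Lemma row3Z c x y z : c *: row3 x y z = row3 (c * x) (c * y) (c * z).
Proof. by apply/rowP; apply: ord3P; rewrite mxE !row3E. Qed.

(** Homogeneity extends the equality from the chart x = 1 to x != 0, and density to the remaining
    plane. *)
Lemma form_eq_affine n F G : is_form n F -> is_form n G ->
  (forall s t, F (row3 1 s t) = G (row3 1 s t)) -> F =1 G.
Proof.
move=> hF hG E; apply: (form_eq_dense hF hG (form_coord R (0 : 'I_3))).
  by exists (row3 1 0 0); rewrite row3E oner_eq0.
move=> v v0; rewrite [v]row3_eta; move: v0.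
move: (v 0 0) (v 0 1) (v 0 2) => x y z x0.
have -> : row3 x y z = x *: row3 1 (y / x) (z / x).
  by rewrite row3Z mulr1 ![x * (_ / x)]mulrC !divfK.
by rewrite (form_homog hF) (form_homog hG) E.
Qed.

Lemma poly2_eq0 (d : {poly {poly R}}) :
  (forall s t : R, d.[t%:P].[s] = 0) -> d = 0.
Proof.
have nil (A : idomainType) (f : nat -> A) (p : {poly A}) :
    injective f -> (forall i, p.[f i] = 0) -> p = 0.
  move=> injf pf; apply/eqP/negPn/negP => pn0.
  have := @max_poly_roots _ p [seq f i | i <- iota 0 (size p)] pn0.
  rewrite map_inj_uniq // iota_uniq size_map size_iota ltnn => H.
  suff /H : all (root p) [seq f i | i <- iota 0 (size p)] by move=> /(_ isT).
  by apply/allP => _ /mapP[i _ ->]; rewrite /root pf.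
have injn : injective (fun i : nat => i%:R : R).
  by move=> i j /eqP; rewrite eqr_nat => /eqP.
move=> d0; apply: (nil _ (fun i : nat => (i%:R : R)%:P)) => [i j /polyC_inj /injn //|i].
by apply: (nil _ _ _ injn) => j; rewrite d0.
Qed.

(** The second coordinate becomes the inner variable s, the third the outer variable t. The last
    clause reads off the coefficient of t^n: the degree in t is exactly [n] as soon as the form is
    nonzero at (0,0,1). *)
Lemma form_dehomog n F : is_form n F -> exists d : {poly {poly R}},
  [/\ forall s t, d.[t%:P].[s] = F (row3 1 s t), tdeg_le n d
    & d`_n`_0 = F (row3 0 0 1)].
Proof.
elim: n F => [|n IH] F.
  case=> c FE; exists (c%:P)%:P; split=> [s t||]; rewrite ?FE ?hornerC //.
    by move=> [|i] [|j] //=; rewrite !coefC /= ?coef0 ?coefC.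
  by rewrite !coefC.
case=> A [hA FE].
have [d0 [E0 t0 _]] := IH _ (hA 0); have [d1 [E1 t1 _]] := IH _ (hA 1).
have [d2 [E2 t2 c2]] := IH _ (hA 2).
exists (d0 + 'X%:P * d1 + d2 * 'X); split=> [s t|i j ij|].
- rewrite FE sum3 !row3E !hornerE E0 E1 E2; ring.
- rewrite !coefD coefCM coefMX mulrC coefMX t0 ?(ltn_trans _ ij) // add0r.
  case: j ij => [|j] ij.
    by rewrite add0r; case: i ij => [|i] ij //=; rewrite ?coef0 // t2.
  rewrite t1 ?add0r; last by rewrite -ltnS -addnS.
  by case: i ij => [|i] ij //=; rewrite ?coef0 // t2.
rewrite !coefD coefCM coefMX mulrC coefMX /= t0 ?addn0 // c2 FE sum3 !row3E.
by ring.
Qed.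

Lemma form_homogenize n (g : {poly {poly R}}) : tdeg_le n g ->
  exists2 G, is_form n G & forall s t, G (row3 1 s t) = g.[t%:P].[s].
Proof.
move=> tg; pose G (v : 'rV[R]_3) := \sum_(i < n.+1) \sum_(j < (n - i).+1)
  g`_i`_j * (v 0 0 ^+ (n - i - j) * v 0 1 ^+ j * v 0 2 ^+ i).
have pow (k : nat) (i : 'I_3) : is_form k (fun v : 'rV[R]_3 => v 0 i ^+ k).
  by have := formX k (form_coord R i); rewrite muln1.
exists G => [|s t].
  apply: form_sum => i; apply: form_sum => j; apply: formZ.
  have := formM (formM (pow (n - i - j)%N 0) (pow j 1)) (pow i 2).
  by congr (is_form _ _); move: (ltn_ord i) (ltn_ord j); lia.
rewrite (horner_coef_wide _ (tdeg_le_size tg)) horner_sum.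
apply: eq_bigr => i _; rewrite hornerM -rmorphXn hornerC /=.
rewrite (@horner_coef_wide _ (n - i).+1) ?mulr_suml; last first.
  by apply/leq_sizeP => j nij; apply: tg; move: (ltn_ord i) nij; lia.
by apply: eq_bigr => j _; rewrite !row3E expr1n mul1r mulrA.
Qed.

End Dehomogenization.

(** * Squares below nonnegative ternary forms *)

Section RealInequalities.
Variable R : realFieldType.
Implicit Types a b c d e x : R.

Lemma quadratic_ge0 a b c : (forall x, 0 <= x ^+ 2 * a + 2 * (x * b) + c) ->
  [/\ 0 <= a, 0 <= c & b ^+ 2 <= a * c].
Proof.
move=> H.
have c0 : 0 <= c by have := H 0; nra.
have a0 : 0 <= a.
  rewrite leNgt; apply/negP => a0.
  have h x : 1 <= x -> 0 <= x * (x * a + 2 * b + c).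
    move=> x1; have := H x.
    have : c <= x * c by nra.
    have : x ^+ 2 * a = x * (x * a) by ring.
    lra.
  (* Chosen so that [x a + 2 b + c = a + 2 (b - |b|)], which is negative when [a] is. *)
  pose x := 1 + (2 * `|b| + c) / (- a).
  have t0 : 0 <= (2 * `|b| + c) / (- a).
    by rewrite divr_ge0 //; [have := normr_ge0 b; lra | lra].
  have x1 : 1 <= x by rewrite /x; lra.
  have : x * a = a - (2 * `|b| + c) by rewrite /x; field; lra.
  by have := h x x1; have := ler_norm b; nra.
split=> //; have [a00|an0] := eqVneq a 0.
  rewrite a00 mul0r.
  suff -> : b = 0 by rewrite expr0n.
  apply/eqP/negPn/negP => bn0.
  have := H (- (c + 1) / (2 * b)); rewrite a00.
  have -> : 2 * (- (c + 1) / (2 * b) * b) = - (c + 1) by field.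
  lra.
have ap : 0 < a by rewrite lt0r an0.
have := H (- b / a).
have -> : (- b / a) ^+ 2 * a + 2 * (- b / a * b) + c = (a * c - b ^+ 2) / a by field.
by rewrite pmulr_lge0 ?invr_gt0 // subr_ge0.
Qed.

(** A polynomial of odd degree changes sign: at [x = 1 + M] the cubic term outweighs the other three
    in absolute value, and it is negative at one of [x] and [- x]. *)
Lemma cubic_ge0 a b c d :
  (forall x, 0 <= a * x ^+ 3 + b * x ^+ 2 + c * x + d) -> a = 0.
Proof.
move=> H; apply/eqP/negPn/negP => an0.
pose M := (`|b| + `|c| + `|d|) / `|a|.
have ap : 0 < `|a| by rewrite normr_gt0.
have M0 : 0 <= M by rewrite divr_ge0 // !addr_ge0.
pose x := 1 + M.
have x1 : 1 <= x by rewrite /x; lra.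
have key : `|b| * x ^+ 2 + `|c| * x + `|d| < `|a| * x ^+ 3.
  have -> : `|a| * x ^+ 3 = (`|a| + (`|b| + `|c| + `|d|)) * x ^+ 2.
    by rewrite exprS mulrA /x /M; congr (_ * _); field; rewrite normr_eq0.
  have h2 : x <= x ^+ 2 by nra.
  have : `|c| * x <= `|c| * x ^+ 2 by rewrite ler_wpM2l.
  have : `|d| * 1 <= `|d| * x ^+ 2 by rewrite ler_wpM2l //; lra.
  have : 0 < `|a| * x ^+ 2 by rewrite mulr_gt0 //; lra.
  lra.
have H1 := H x.
have H2 : 0 <= - (a * x ^+ 3) + b * x ^+ 2 - c * x + d.
  by have := H (- x); congr (_ <= _); ring.
have x20 : 0 <= x ^+ 2 by rewrite sqr_ge0.
have bx : b * x ^+ 2 <= `|b| * x ^+ 2 by rewrite ler_wpM2r // ler_norm.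
have cx : `|c * x| = `|c| * x by rewrite normrM [`|x|]ger0_norm //; lra.
have := ler_norm (c * x); have := ler_norm (- (c * x)).
rewrite normrN cx; have := ler_norm d.
by case: (ger0P a) key => _; rewrite ?mulNr; lra.
Qed.

End RealInequalities.

Section SquareMinorants.
Variable R : realType.
Implicit Types (F G r : 'rV[R]_3 -> R) (u v w : 'rV[R]_3) (M : 'M[R]_3).
Implicit Types a b c d e x y z : R.

Lemma is_formS n i F : is_form n F -> is_form n.+1 (fun v => v 0 i * F v).
Proof. by move=> hF; apply: (@formM _ _ 1); [exact: form_coord|]. Qed.

(** The separate factor [e] fits the completed squares below, which have the shape a^-1 r^2, and
    avoids square roots. *)
Definition square_minorant m G := exists (r : 'rV[R]_3 -> R) (e : R),
  [/\ is_form m r, exists w, r w != 0, 0 < e & forall v, e * r v ^+ 2 <= G v].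

Lemma square_minorant_mulmx m G M : M \in unitmx ->
  square_minorant m (fun v => G (v *m M)) -> square_minorant m G.
Proof.
move=> uM [r [e [hr [w rw] e0 H]]].
exists (fun v => r (v *m invmx M)), e; split=> //.
- exact: form_mulmx.
- by exists (w *m M); rewrite mulmxK.
- by move=> v; have := H (v *m invmx M); rewrite mulmxKV.
Qed.

Lemma unitmx_row i v : v != 0 ->
  exists2 M, M \in unitmx & delta_mx 0 i *m M = v.
Proof.
move=> vn0; pose f : 'M[R]_3 := \matrix_(k, j) v 0 j.
have df : delta_mx 0 i *m f = v.
  by rewrite -rowE; apply/rowP => j; rewrite !mxE.
have [|M uM E] := @complete_unitmx _ _ _ (delta_mx 0 i : 'rV[R]_3) f.
  by rewrite df mxrank_delta rank_rV vn0.
by exists M => //; rewrite -E.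
Qed.

Lemma form1E F : is_form 1 F -> exists a b c, forall x y z,
  F (row3 x y z) = a * x + b * y + c * z.
Proof.
case=> A [hA FE]; have [a aE] := hA 0; have [b bE] := hA 1; have [c cE] := hA 2.
exists a, b, c => x y z; rewrite FE sum3 !row3E aE bE cE; ring.
Qed.

Lemma form2E F : is_form 2 F -> exists a b c d e f, forall x y z,
  F (row3 x y z) = x ^+ 2 * a + x * (b * y + c * z)
    + (d * y ^+ 2 + e * (y * z) + f * z ^+ 2).
Proof.
case=> A [hA FE].
have [a0 [b0 [c0 E0]]] := form1E (hA 0).
have [a1 [b1 [c1 E1]]] := form1E (hA 1).
have [a2 [b2 [c2 E2]]] := form1E (hA 2).
exists a0, (b0 + a1), (c0 + a2), b1, (c1 + b2), c2 => x y z.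
rewrite FE sum3 !row3E E0 E1 E2; ring.
Qed.

Lemma form3E F : is_form 3 F -> exists a b c d e f g h i j, forall x y z,
  F (row3 x y z) = x ^+ 3 * a + x ^+ 2 * (b * y + c * z)
    + x * (d * y ^+ 2 + e * (y * z) + f * z ^+ 2)
    + (g * y ^+ 3 + h * (y ^+ 2 * z) + i * (y * z ^+ 2) + j * z ^+ 3).
Proof.
case=> A [hA FE].
have [a0 [b0 [c0 [d0 [e0 [f0 E0]]]]]] := form2E (hA 0).
have [a1 [b1 [c1 [d1 [e1 [f1 E1]]]]]] := form2E (hA 1).
have [a2 [b2 [c2 [d2 [e2 [f2 E2]]]]]] := form2E (hA 2).
exists a0, (b0 + a1), (c0 + a2), (d0 + b1), (e0 + c1 + b2), (f0 + c2).
exists d1, (e1 + d2), (f1 + e2), f2 => x y z.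
rewrite FE sum3 !row3E E0 E1 E2; ring.
Qed.

Definition cubic2 a b c d (y z : R) :=
  a * y ^+ 3 + b * (y ^+ 2 * z) + c * (y * z ^+ 2) + d * z ^+ 3.
Definition quadratic2 a b c (y z : R) :=
  a * y ^+ 2 + 2 * b * (y * z) + c * z ^+ 2.
Definition quartic2 a b c d e (y z : R) :=
  a * y ^+ 4 + b * (y ^+ 3 * z) + c * (y ^+ 2 * z ^+ 2) + d * (y * z ^+ 3)
    + e * z ^+ 4.

Lemma form4E F : is_form 4 F -> exists p q1 q2 a b c d0 d1 d2 d3 k0 k1 k2 k3 k4,
  forall x y z, F (row3 x y z) = x ^+ 4 * p + x ^+ 3 * (q1 * y + q2 * z)
    + x ^+ 2 * quadratic2 a b c y z + 2 * (x * cubic2 d0 d1 d2 d3 y z)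
    + quartic2 k0 k1 k2 k3 k4 y z.
Proof.
case=> A [hA FE].
have [a0 [b0 [c0 [d0 [e0 [f0 [g0 [h0 [i0 [j0 E0]]]]]]]]]] := form3E (hA 0).
have [a1 [b1 [c1 [d1 [e1 [f1 [g1 [h1 [i1 [j1 E1]]]]]]]]]] := form3E (hA 1).
have [a2 [b2 [c2 [d2 [e2 [f2 [g2 [h2 [i2 [j2 E2]]]]]]]]]] := form3E (hA 2).
exists a0, (b0 + a1), (c0 + a2).
exists (d0 + b1), ((e0 + c1 + b2) / 2), (f0 + c2).
exists ((g0 + d1) / 2), ((h0 + e1 + d2) / 2), ((i0 + f1 + e2) / 2), ((j0 + f2) / 2).
exists g1, (h1 + g2), (i1 + h2), (j1 + i2), j2 => x y z.
rewrite FE sum3 !row3E E0 E1 E2 /quadratic2 /cubic2 /quartic2.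
by field.
Qed.

(** The zero (1,0,0) removes x^4. For fixed y, z the form is then a nonnegative cubic in x, so its
    x^3 coefficient vanishes too. The factor 2 on the linear term prepares for [quadratic_ge0]. *)
Lemma quartic_at_zero G : is_form 4 G -> (forall v, 0 <= G v) ->
  G (row3 1 0 0) = 0 -> exists a b c d0 d1 d2 d3 k0 k1 k2 k3 k4,
  forall x y z, G (row3 x y z) =
    x ^+ 2 * quadratic2 a b c y z + 2 * (x * cubic2 d0 d1 d2 d3 y z)
    + quartic2 k0 k1 k2 k3 k4 y z.
Proof.
move=> hG G0 Ge1.
have [p [q1 [q2 [a [b [c [d0 [d1 [d2 [d3 [k0 [k1 [k2 [k3 [k4 GE]]]]]]]]]]]]]]] :=
  form4E hG.
have p0 : p = 0 by move: Ge1; rewrite GE /quadratic2 /cubic2 /quartic2; lra.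
have q0 y z : q1 * y + q2 * z = 0.
  apply: (@cubic_ge0 _ _ (quadratic2 a b c y z) (2 * cubic2 d0 d1 d2 d3 y z)
    (quartic2 k0 k1 k2 k3 k4 y z)) => x.
  by have := G0 (row3 x y z); rewrite GE p0; congr (_ <= _); ring.
exists a, b, c, d0, d1, d2, d3, k0, k1, k2, k3, k4 => x y z.
by rewrite GE p0 q0; ring.
Qed.

Lemma is_form_monomial i j (k l : nat) : is_form (k + l) (fun v => v 0 i ^+ k * v 0 j ^+ l).
Proof.
have pow n (p : 'I_3) : is_form n (fun v : 'rV[R]_3 => v 0 p ^+ n).
  by have := formX n (form_coord R p); rewrite muln1.
exact: formM.
Qed.

Lemma is_form_linear2 b c i j : is_form 1 (fun v => b * v 0 i + c * v 0 j).
Proof. by apply: formD; apply: formZ; apply: form_coord. Qed.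

Lemma is_form_quadratic2 a b c i j :
  is_form 2 (fun v => quadratic2 a b c (v 0 i) (v 0 j)).
Proof.
have := formD (formD (formZ a (is_form_monomial i j 2 0))
  (formZ (2 * b) (is_form_monomial i j 1 1))) (formZ c (is_form_monomial i j 0 2)).
by apply: eq_form => v; rewrite /quadratic2 /=; ring.
Qed.

Lemma is_form_cubic2 a b c d i j :
  is_form 3 (fun v => cubic2 a b c d (v 0 i) (v 0 j)).
Proof.
have := formD (formD (formD (formZ a (is_form_monomial i j 3 0))
  (formZ b (is_form_monomial i j 2 1))) (formZ c (is_form_monomial i j 1 2)))
  (formZ d (is_form_monomial i j 0 3)).
by apply: eq_form => v; rewrite /cubic2 /=; ring.
Qed.

Lemma is_form_quartic2 a b c d e i j :
  is_form 4 (fun v => quartic2 a b c d e (v 0 i) (v 0 j)).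
Proof.
have := formD (formD (formD (formD (formZ a (is_form_monomial i j 4 0))
  (formZ b (is_form_monomial i j 3 1))) (formZ c (is_form_monomial i j 2 2)))
  (formZ d (is_form_monomial i j 1 3))) (formZ e (is_form_monomial i j 0 4)).
by apply: eq_form => v; rewrite /quartic2 /=; ring.
Qed.

(** A form in y, z alone vanishes at (1,0,0), so [form_pos_bound] does not apply to it in three
    variables. Adding x^(2n) makes it positive definite; afterwards x is set to 0. *)
Lemma binary_pos_bound n (f g : R -> R -> R) : (0 < n)%N ->
  is_form n.*2 (fun v : 'rV[R]_3 => f (v 0 1) (v 0 2)) ->
  is_form n.*2 (fun v : 'rV[R]_3 => g (v 0 1) (v 0 2)) ->
  (forall y z, 0 < y ^+ 2 + z ^+ 2 -> 0 < f y z) ->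
  exists2 e, 0 < e & forall y z, e * g y z <= f y z.
Proof.
move=> n0 hf hg fpos.
have hx : is_form n.*2 (fun v : 'rV[R]_3 => v 0 0 ^+ n.*2).
  by have := formX n.*2 (form_coord R (0 : 'I_3)); rewrite muln1.
have [||e e0 H] := form_pos_bound _ (formD hx hf) hg; first by rewrite double_gt0.
  move=> v vn0; have xge0 : 0 <= v 0 0 ^+ n.*2 by rewrite -muln2 exprM sqr_ge0.
  have [yz|] := ltP 0 (v 0 1 ^+ 2 + v 0 2 ^+ 2).
    by have := fpos _ _ yz; lra.
  move=> yz; have y20 := sqr_ge0 (v 0 1); have z20 := sqr_ge0 (v 0 2).
  have /eqP : v 0 1 ^+ 2 = 0 by lra.
  have /eqP : v 0 2 ^+ 2 = 0 by lra.
  rewrite !sqrf_eq0 => /eqP z0 /eqP y0.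
  have := form_homog hf 0 v; rewrite !mxE !mul0r expr0n double_eq0 eqn0Ngt n0 /=.
  rewrite mul0r y0 z0 => ->; rewrite addr0 lt0r xge0 andbT expf_eq0.
  rewrite double_gt0 n0 /=; apply: contra_neq vn0 => x0.
  by rewrite [v]row3_eta x0 y0 z0; apply/rowP; apply: ord3P; rewrite row3E mxE.
exists e => // y z; have := H (row3 0 y z).
by rewrite !row3E expr0n double_eq0 eqn0Ngt n0 add0r.
Qed.

(** Sends (0,0,1) to ([a], [y0], [z0]) and fixes (1,0,0): a newly found direction or zero is
    normalized without disturbing the first zero. *)
Lemma shear_unitmx a y0 z0 : 0 < y0 ^+ 2 + z0 ^+ 2 ->
  exists2 M, M \in unitmx & forall x y z, row3 x y z *m M =
    row3 (x + a * z) (y0 * z - z0 * y) (y0 * y + z0 * z).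
Proof.
move=> n0; pose M : 'M[R]_3 :=
  \matrix_(i < 3) nth 0 [:: row3 1 0 0; row3 0 (- z0) y0; row3 a y0 z0] i.
have ME x y z : row3 x y z *m M =
    row3 (x + a * z) (y0 * z - z0 * y) (y0 * y + z0 * z).
  rewrite mulmx_sum_row sum3 !rowK !row3E /= !row3Z.
  by apply/rowP; apply: ord3P; rewrite !mxE /=; ring.
exists M => //; rewrite -row_free_unit; apply: inj_row_free => v.
rewrite [v]row3_eta ME; move: (v 0 0) (v 0 1) (v 0 2) => x y z E.
have := congr1 (fun w : 'rV_3 => w 0 0) E; have := congr1 (fun w : 'rV_3 => w 0 1) E.
have := congr1 (fun w : 'rV_3 => w 0 2) E; rewrite !row3E !mxE => E2 E1 E0.
have z00 : z = 0.
  apply: (mulfI (lt0r_neq0 n0)); rewrite mulr0.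
  have -> : (y0 ^+ 2 + z0 ^+ 2) * z = y0 * (y0 * z - z0 * y) + z0 * (y0 * y + z0 * z).
    by ring.
  by rewrite E1 E2 !mulr0 addr0.
have y00 : y = 0.
  apply: (mulfI (lt0r_neq0 n0)); rewrite mulr0.
  have -> : (y0 ^+ 2 + z0 ^+ 2) * y = y0 * (y0 * y + z0 * z) - z0 * (y0 * z - z0 * y).
    by ring.
  by rewrite E1 E2 !mulr0 subr0.
have x00 : x = 0 by move: E0; rewrite z00 mulr0 addr0.
by rewrite x00 y00 z00; apply/rowP; apply: ord3P; rewrite row3E mxE.
Qed.

(** A positive binary quartic exceeds some [e (y^2 + z^2)^2]. Otherwise a zero is moved to y = 0, z
    = 1; nonnegativity then removes z^4 and y z^3, and what remains is y^2 times a nonnegative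
    quadratic form, whose square is completed. *)
Lemma square_minorant_cyl G k0 k1 k2 k3 k4 : is_form 4 G -> (forall v, 0 <= G v) ->
  (exists w, G w != 0) ->
  (forall x y z, G (row3 x y z) = quartic2 k0 k1 k2 k3 k4 y z) ->
  square_minorant 2 G.
Proof.
move=> hG G0 Gn GE.
case: (pselect (forall y z, 0 < y ^+ 2 + z ^+ 2 -> 0 < quartic2 k0 k1 k2 k3 k4 y z)).
  move=> pos.
  have [//||e e0 H] := @binary_pos_bound 2 _
    (fun y z => quadratic2 1 0 1 y z ^+ 2) _ (is_form_quartic2 k0 k1 k2 k3 k4 1 2) _ pos.
    exact: (formX 2 (is_form_quadratic2 1 0 1 1 2)).
  exists (fun v => quadratic2 1 0 1 (v 0 1) (v 0 2)), e; split=> //.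
  - exact: is_form_quadratic2.
  - exists (row3 0 1 0); rewrite !row3E /quadratic2.
    by rewrite (_ : _ + _ = 1) ?oner_eq0 //; ring.
  - by move=> v; rewrite [in leRHS](row3_eta v) GE.
move=> /existsNP[y0 /existsNP[z0 /not_implyP[n0 /negP]]]; rewrite -leNgt => q0.
have [M uM ME] := shear_unitmx 0 n0; apply: (square_minorant_mulmx uM).
have hG' := form_mulmx M hG.
have [|a [b [c [d0 [d1 [d2 [d3 [l0 [l1 [l2 [l3 [l4 GE']]]]]]]]]]]] :=
  quartic_at_zero hG' (fun v => G0 _).
  by rewrite ME GE /quartic2; ring.
have {}GE' x y z : G (row3 x y z *m M) = quartic2 l0 l1 l2 l3 l4 y z.
  have := GE' 0 y z; rewrite !ME !GE => ->; rewrite /quartic2; ring.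
have l40 : l4 = 0.
  have := GE' 0 0 1; rewrite ME GE mulr1 mulr0 !subr0 mulr0 mulr1 add0r => E.
  have : quartic2 k0 k1 k2 k3 k4 y0 z0 = 0.
    by apply/eqP; rewrite eq_le q0 -(GE 0) G0.
  by rewrite E /quartic2 => <-; ring.
have l30 : l3 = 0.
  apply: (@cubic_ge0 _ _ l2 l1 l0) => z.
  by have := G0 (row3 0 1 z *m M); rewrite GE' l40 /quartic2; congr (_ <= _); ring.
have [l2ge l0ge disc] : [/\ 0 <= l2, 0 <= l0 & (l1 / 2) ^+ 2 <= l2 * l0].
  apply: quadratic_ge0 => z.
  have := G0 (row3 0 1 z *m M); rewrite GE' l40 l30 /quartic2.
  by congr (_ <= _); field.
have {}GE' x y z : G (row3 x y z *m M) = y ^+ 2 * quadratic2 l0 (l1 / 2) l2 y z.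
  by rewrite GE' l40 l30 /quartic2 /quadratic2; field.
have [l20|l2n] := eqVneq l2 0.
  have l10 : l1 = 0.
    have : (l1 / 2) ^+ 2 = 0 by have := sqr_ge0 (l1 / 2); rewrite l20 mul0r in disc; lra.
    by move/eqP; rewrite sqrf_eq0 => /eqP; lra.
  have l0p : 0 < l0.
    rewrite lt0r l0ge andbT; apply/eqP => l00; case: Gn => w /eqP; apply.
    have := GE' ((w *m invmx M) 0 0) ((w *m invmx M) 0 1) ((w *m invmx M) 0 2).
    rewrite -row3_eta mulmxKV // => ->; rewrite l00 l10 l20 /quadratic2; ring.
  exists (fun v => quadratic2 1 0 0 (v 0 1) (v 0 2)), l0; split=> //.
  - exact: is_form_quadratic2.
  - exists (row3 0 1 0); rewrite !row3E /quadratic2.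
    by rewrite (_ : _ + _ = 1) ?oner_eq0 //; ring.
  - move=> v; rewrite [in leRHS](row3_eta v) GE' l10 l20 /quadratic2.
    by rewrite le_eqVlt; apply/orP; left; apply/eqP; ring.
have l2p : 0 < l2 by rewrite lt0r l2n.
exists (fun v => v 0 1 * (l1 / 2 * v 0 1 + l2 * v 0 2)), l2^-1; split=> //.
- by apply: is_formS; apply: is_form_linear2.
- exists (row3 0 1 ((1 - l1 / 2) / l2)); rewrite !row3E.
  by rewrite (_ : _ * _ = 1) ?oner_eq0 //; field.
- by rewrite invr_gt0.
move=> v; rewrite [in leRHS](row3_eta v) GE'.
move: (v 0 1) (v 0 2) => y z; rewrite -subr_ge0.
have -> : y ^+ 2 * quadratic2 l0 (l1 / 2) l2 y z -
    l2^-1 * (y * (l1 / 2 * y + l2 * z)) ^+ 2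
  = (y ^+ 2) ^+ 2 * (l2 * l0 - (l1 / 2) ^+ 2) / l2.
  by rewrite /quadratic2; field.
by rewrite divr_ge0 // mulr_ge0 ?sqr_ge0 // subr_ge0.
Qed.

(* The x^2-coefficient of G is encoded by the second difference of its values at
   x = -1, 0, 1, which keeps the case distinction invariant under linear maps. *)
Lemma square_minorant_degenerate G : is_form 4 G -> (forall v, 0 <= G v) ->
  (exists w, G w != 0) -> G (row3 1 0 0) = 0 ->
  G (row3 1 0 1) + G (row3 (-1) 0 1) <= 2 * G (row3 0 0 1) ->
  square_minorant 2 G.
Proof.
move=> hG G0 Gn Ge1 Hess.
have [a [b [c [d0 [d1 [d2 [d3 [k0 [k1 [k2 [k3 [k4 GE]]]]]]]]]]]] :=
  quartic_at_zero hG G0 Ge1.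
have psd y z : [/\ 0 <= quadratic2 a b c y z, 0 <= quartic2 k0 k1 k2 k3 k4 y z &
    cubic2 d0 d1 d2 d3 y z ^+ 2 <= quadratic2 a b c y z * quartic2 k0 k1 k2 k3 k4 y z].
  by apply: quadratic_ge0 => x; rewrite -GE.
have [ap cp disc] : [/\ 0 <= a, 0 <= c & b ^+ 2 <= a * c].
  apply: quadratic_ge0 => x; have [+ _ _] := psd x 1.
  by rewrite /quadratic2; congr (_ <= _); ring.
have c0 : c = 0.
  move: Hess; rewrite !GE.
  have [_ _] := psd 0 1; rewrite /quadratic2 /cubic2 /quartic2; lra.
have b0 : b = 0 by apply/eqP; rewrite -sqrf_eq0; have := sqr_ge0 b; rewrite c0 in disc; lra.
have d30 : d3 = 0.
  have [_ _] := psd 0 1; rewrite c0 b0 /quadratic2 /cubic2 => H.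
  apply/eqP; rewrite -sqrf_eq0; have := sqr_ge0 d3; rewrite eq_le => ->; rewrite andbT.
  by move: H; congr (_ <= _); ring.
(* With [a = 0] the whole x^2 coefficient vanishes, the discriminant bound removes the x-linear
   term, and x no longer occurs. *)
have [a0|an0] := eqVneq a 0.
  apply: (square_minorant_cyl hG G0 Gn) => x y z.
  rewrite GE.
  have [_ _] := psd y z.
  have -> : quadratic2 a b c y z = 0 by rewrite a0 b0 c0 /quadratic2; ring.
  rewrite mul0r => H; have /eqP : cubic2 d0 d1 d2 d3 y z ^+ 2 = 0.
    by have := sqr_ge0 (cubic2 d0 d1 d2 d3 y z); lra.
  by rewrite sqrf_eq0 => /eqP ->; ring.
have {}ap : 0 < a by rewrite lt0r an0.
(* Now the x^2 coefficient is a y^2, and since [d3 = 0] the x-linear one is divisible by y.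
   Completing the square divides out that y, and [a G - r^2] is free of x. *)
pose r v := a * (v 0 0 * v 0 1) + quadratic2 d0 (d1 / 2) d2 (v 0 1) (v 0 2).
have hr : is_form 2 r.
  apply: formD; last exact: is_form_quadratic2.
  by apply: formZ; apply: is_formS; apply: form_coord.
have GrE x y z : a * G (row3 x y z) - r (row3 x y z) ^+ 2 =
    a * quartic2 k0 k1 k2 k3 k4 y z - quadratic2 d0 (d1 / 2) d2 y z ^+ 2.
  by rewrite GE /r !row3E b0 c0 d30 /quadratic2 /cubic2; field.
exists r, a^-1; split=> //.
- exists (row3 ((1 - d0) / a) 1 0); rewrite /r !row3E.
  by rewrite (_ : _ + _ = 1) ?oner_eq0 // /quadratic2; field.
- by rewrite invr_gt0.
suff H v : 0 <= a * G v - r v ^+ 2.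
  by move=> v; rewrite mulrC ler_pdivrMr // [G v * a]mulrC -subr_ge0.
apply: (form_ge0_dense (formB (formZ a hG) (formX 2 hr)) (form_coord R (1 : 'I_3))).
  by exists (row3 0 1 0); rewrite row3E oner_eq0.
move=> {}v; rewrite [v]row3_eta row3E; move: (v 0 0) (v 0 1) (v 0 2) => x y z y0.
(* Since x does not matter, it is replaced by the root of [r], where the difference is [a G]. *)
rewrite GrE -(GrE (- quadratic2 d0 (d1 / 2) d2 y z / (a * y))).
have -> : r (row3 (- quadratic2 d0 (d1 / 2) d2 y z / (a * y)) y z) = 0.
  by rewrite /r !row3E; field; rewrite ?an0 ?y0.
by rewrite expr0n subr0 mulr_ge0 // ltW.
Qed.

Lemma quadratic2_factor a b c y0 z0 : 0 < y0 ^+ 2 + z0 ^+ 2 ->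
  quadratic2 a b c y0 z0 = 0 ->
  exists p q, forall y z, quadratic2 a b c y z = (z0 * y - y0 * z) * (p * y + q * z).
Proof.
move=> n0; rewrite /quadratic2 => E.
have [z00|zn0] := eqVneq z0 0.
  have yn0 : y0 != 0 by apply: contraTneq n0 => ->; rewrite z00 expr0n addr0 ltxx.
  have a0 : a = 0.
    apply: (mulIf (expf_neq0 2 yn0)); rewrite mul0r -[RHS]E z00; ring.
  exists (- 2 * b / y0), (- c / y0) => y z; rewrite a0 z00; field.
  exact: yn0.
exists (a / z0), ((2 * b + y0 * (a / z0)) / z0) => y z.
have -> : c = - (a * y0 ^+ 2 + 2 * b * (y0 * z0)) / z0 ^+ 2.
  by apply: (mulIf (expf_neq0 2 zn0)); rewrite divfK ?expf_neq0 //; lra.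
field; exact: zn0.
Qed.

(** The zero (0,1,0) removes y^4 and every y^3 term, so G = x^2 f2 + 2 x z g2 + z^2 h2 with binary
    quadratic forms. Then f2 G = (x f2 + z g2)^2 + z^2 D with D = f2 h2 - g2^2. If D is positive, it
    exceeds e z^2 f2, so G >= e z^4; if not, a zero of D is exploited. *)
Lemma square_minorant_two_zeros G : is_form 4 G -> (forall v, 0 <= G v) ->
  G (row3 1 0 0) = 0 -> G (row3 0 1 0) = 0 ->
  (forall y z, 0 < y ^+ 2 + z ^+ 2 ->
    2 * G (row3 0 y z) < G (row3 1 y z) + G (row3 (-1) y z)) ->
  square_minorant 2 G.
Proof.
move=> hG G0 Ge1 Ge2 Hess.
have [a [b [c [d0 [d1 [d2 [d3 [k0 [k1 [k2 [k3 [k4 GE]]]]]]]]]]]] :=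
  quartic_at_zero hG G0 Ge1.
pose f2 := quadratic2 a b c.
have f2p y z : 0 < y ^+ 2 + z ^+ 2 -> 0 < f2 y z.
  by move=> /Hess; rewrite !GE /f2; lra.
have k00 : k0 = 0.
  by move: Ge2; rewrite GE /quadratic2 /cubic2 /quartic2; lra.
have cub x z : 2 * d0 * x + k1 * z = 0.
  apply: (@cubic_ge0 _ _ (x ^+ 2 * a + 2 * x * d1 * z + k2 * z ^+ 2)
     (2 * x ^+ 2 * b * z + 2 * x * d2 * z ^+ 2 + k3 * z ^+ 3)
     (x ^+ 2 * c * z ^+ 2 + 2 * x * d3 * z ^+ 3 + k4 * z ^+ 4)) => y.
  have := G0 (row3 x y z); rewrite GE k00 /quadratic2 /cubic2 /quartic2.
  by congr (_ <= _); ring.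
have d00 : d0 = 0 by have := cub 1 0; lra.
have k10 : k1 = 0 by have := cub 0 1; lra.
pose g2 := quadratic2 d1 (d2 / 2) d3; pose h2 := quadratic2 k2 (k3 / 2) k4.
have {}GE x y z : G (row3 x y z) = x ^+ 2 * f2 y z + 2 * (x * (z * g2 y z)) + z ^+ 2 * h2 y z.
  by rewrite GE k00 d00 k10 /f2 /g2 /h2 /quadratic2 /cubic2 /quartic2; field.
pose D y z := f2 y z * h2 y z - g2 y z ^+ 2.
have hD : is_form 4 (fun v => D (v 0 1) (v 0 2)).
  apply: formB; last exact: (formX 2 (is_form_quadratic2 _ _ _ _ _)).
  by apply: (@formM _ _ 2 2); exact: is_form_quadratic2.
have D0 y z : 0 <= D y z.
  have := form_ge0_dense hD (form_coord R (2 : 'I_3)) _ _ (row3 0 y z).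
  rewrite !row3E; apply; first by exists (row3 0 0 1); rewrite row3E oner_eq0.
  move=> v; move: (v 0 1) (v 0 2) => {}y {}z zn0.
  have [|_ _] := @quadratic_ge0 _ (f2 y z) (z * g2 y z) (z ^+ 2 * h2 y z).
    by move=> x; rewrite -GE.
  rewrite exprMn [f2 y z * _]mulrCA ler_pM2l ?subr_ge0 //.
  by rewrite lt0r sqr_ge0 andbT expf_neq0.
have ltg0 y z : ~~ (0 < y ^+ 2 + z ^+ 2) -> y = 0 /\ z = 0.
  rewrite -leNgt => n0; have := sqr_ge0 y; have := sqr_ge0 z => z2 y2.
  by split; apply/eqP; rewrite -sqrf_eq0; apply/eqP; lra.
case: (pselect (forall y z, 0 < y ^+ 2 + z ^+ 2 -> 0 < D y z)) => [pos|].
  have [//||e e0 H] := @binary_pos_bound 2 _ (fun y z => z ^+ 2 * f2 y z) _ hD _ pos.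
    apply: (@formM _ _ 2 2); last exact: is_form_quadratic2.
    by have := formX 2 (form_coord R (2 : 'I_3)).
  exists (fun v => v 0 2 ^+ 2), e; split=> //.
  - by have := formX 2 (form_coord R (2 : 'I_3)).
  - by exists (row3 0 0 1); rewrite row3E expr1n oner_eq0.
  move=> v; case: (boolP (0 < v 0 1 ^+ 2 + v 0 2 ^+ 2)) => [n0|/ltg0[y0 z0]]; last first.
    by rewrite z0 expr0n expr0n mulr0.
  rewrite [in leRHS](row3_eta v) GE; move: (v 0 0) (v 0 1) (v 0 2) n0 => x y z n0.
  rewrite -(ler_pM2r (f2p _ _ n0)) -subr_ge0.
  have -> : (x ^+ 2 * f2 y z + 2 * (x * (z * g2 y z)) + z ^+ 2 * h2 y z) * f2 y z
      - e * (z ^+ 2) ^+ 2 * f2 y z = (x * f2 y z + z * g2 y z) ^+ 2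
      + z ^+ 2 * (D y z - e * (z ^+ 2 * f2 y z)) by rewrite /D; ring.
  by rewrite addr_ge0 ?sqr_ge0 // mulr_ge0 ?sqr_ge0 // subr_ge0.
move=> /existsNP[y0 /existsNP[z0 /not_implyP[n0 /negP]]]; rewrite -leNgt => Dle.
have Dz : D y0 z0 = 0 by apply/eqP; rewrite eq_le Dle D0.
have fn0 : f2 y0 z0 != 0 by rewrite lt0r_neq0 // f2p.
(* After the shift x - t z the remaining two coefficients g3 and h3 are divisible
   by the linear form l vanishing at (y0, z0). *)
pose t := - g2 y0 z0 / f2 y0 z0.
pose g3 y z := g2 y z + t * f2 y z.
pose h3 y z := h2 y z + 2 * t * g2 y z + t ^+ 2 * f2 y z.
have {}GE x y z : G (row3 x y z) = (x - t * z) ^+ 2 * f2 y z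
    + 2 * ((x - t * z) * (z * g3 y z)) + z ^+ 2 * h3 y z.
  by rewrite GE /g3 /h3; ring.
have DE y z : D y z = f2 y z * h3 y z - g3 y z ^+ 2 by rewrite /D /g3 /h3; ring.
have g3z : g3 y0 z0 = 0 by rewrite /g3 /t; field.
have h3z : h3 y0 z0 = 0.
  by move: Dz; rewrite DE g3z expr0n subr0 => /eqP; rewrite mulf_eq0 (negPf fn0) => /eqP.
have h30 y z : 0 <= h3 y z.
  case: (boolP (0 < y ^+ 2 + z ^+ 2)) => [nyz|/ltg0[-> ->]]; last first.
    by rewrite /h3 /h2 /g2 /f2 /quadratic2 (_ : _ + _ = 0) //; ring.
  rewrite -(pmulr_rge0 _ (f2p _ _ nyz)).
  by have := D0 y z; rewrite DE; have := sqr_ge0 (g3 y z); lra.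
pose l y z := z0 * y - y0 * z.
have [p [q g3E]] : exists p q, forall y z, g3 y z = l y z * (p * y + q * z).
  have [|p [q E]] := @quadratic2_factor (d1 + t * a) (d2 / 2 + t * b) (d3 + t * c) _ _ n0.
    by rewrite -[RHS]g3z /g3 /g2 /f2 /quadratic2; ring.
  by exists p, q => y z; rewrite -E /g3 /g2 /f2 /quadratic2; ring.
have [p' [q' h3E]] : exists p q, forall y z, h3 y z = l y z * (p * y + q * z).
  have [|p' [q' E]] := @quadratic2_factor (k2 + 2 * t * d1 + t ^+ 2 * a)
     (k3 / 2 + 2 * t * (d2 / 2) + t ^+ 2 * b) (k4 + 2 * t * d3 + t ^+ 2 * c) _ _ n0.
    by rewrite -[RHS]h3z /h3 /h2 /g2 /f2 /quadratic2; ring.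
  by exists p', q' => y z; rewrite -E /h3 /h2 /g2 /f2 /quadratic2; ring.
pose n := y0 ^+ 2 + z0 ^+ 2; have nn0 : n != 0 by rewrite lt0r_neq0.
(* A zero of the nonnegative [h3] is double: along ([z0], [- y0]) through the zero, [h3] is a
   quadratic polynomial without constant term, so its linear term vanishes too. *)
have pq0 : p' * y0 + q' * z0 = 0.
  have [|_ _] := @quadratic_ge0 _ (n * (p' * z0 - q' * y0)) (n * (p' * y0 + q' * z0) / 2) 0.
    move=> x; have := h30 (y0 + x * z0) (z0 - x * y0); rewrite h3E /l /n.
    by congr (_ <= _); field.
  rewrite mulr0 => H; have /eqP : (n * (p' * y0 + q' * z0) / 2) ^+ 2 = 0.
    by have := sqr_ge0 (n * (p' * y0 + q' * z0) / 2); lra.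
  by rewrite sqrf_eq0 !mulf_eq0 (negPf nn0) invr_eq0 pnatr_eq0 orbF => /eqP.
pose k := (p' * z0 - q' * y0) / n.
have {}h3E y z : h3 y z = k * l y z ^+ 2.
  rewrite h3E (_ : k * _ = l y z * (k * l y z)); last by ring.
  congr (_ * _).
  have pE : p' = k * z0 + (p' * y0 + q' * z0) / n * y0 by rewrite /k /n; field.
  have qE : q' = - k * y0 + (p' * y0 + q' * z0) / n * z0 by rewrite /k /n; field.
  by move: pE qE; rewrite pq0 => {1}-> {1}->; rewrite /l; ring.
have k0' : 0 <= k.
  have := h30 z0 (- y0); rewrite h3E.
  have -> : l z0 (- y0) = n by rewrite /l /n; ring.
  by rewrite pmulr_lge0 // exprn_gt0.
(* This is [D >= 0] with the common factor [l^2] cancelled, by density where [l] vanishes. *)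
have kf y z : 0 <= k * f2 y z - (p * y + q * z) ^+ 2.
  have hF : is_form 2 (fun v => k * f2 (v 0 1) (v 0 2) - (p * v 0 1 + q * v 0 2) ^+ 2).
    apply: formB; first by apply: formZ; exact: is_form_quadratic2.
    exact: (formX 2 (is_form_linear2 _ _ _ _)).
  have := form_ge0_dense hF (is_form_linear2 z0 (- y0) 1 2) _ _ (row3 0 y z).
  rewrite !row3E; apply.
    exists (row3 0 z0 (- y0)); rewrite !row3E.
    by rewrite (_ : _ + _ = n) // /n; ring.
  move=> v; rewrite mulNr -/(l (v 0 1) (v 0 2)).
  move: (v 0 1) (v 0 2) => {}y {}z ln0.
  have l2 : 0 < l y z ^+ 2 by rewrite lt0r sqr_ge0 andbT expf_neq0.
  rewrite -(pmulr_rge0 _ l2); have := D0 y z; rewrite DE g3E h3E.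
  by congr (_ <= _); ring.
(* If [k = 0], then p y + q z vanishes identically and G = (x - t z)^2 f2; a square below [f2] is
   obtained by completing it in y. *)
have [k00'|kn0] := eqVneq k 0.
  have ap : 0 < a.
    have := @f2p 1 0; rewrite expr1n expr0n addr0 ltr01 => /(_ isT).
    by rewrite /f2 /quadratic2; congr (_ < _); ring.
  have [_ _ disc] : [/\ 0 <= a, 0 <= c & b ^+ 2 <= a * c].
    apply: quadratic_ge0 => x.
    have : 0 < x ^+ 2 + 1 ^+ 2 by rewrite expr1n; have := sqr_ge0 x; lra.
    by move=> /f2p /ltW; rewrite /f2 /quadratic2; congr (_ <= _); ring.
  exists (fun v => (v 0 0 - t * v 0 2) * (a * v 0 1 + b * v 0 2)), a^-1; split=> //.
  - apply: (@formM _ _ 1 1); last exact: is_form_linear2.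
    by apply: formB; [|apply: formZ]; exact: form_coord.
  - exists (row3 1 1 0); rewrite !row3E (_ : _ * _ = a) ?lt0r_neq0 //; ring.
  - by rewrite invr_gt0.
  move=> v; rewrite [in leRHS](row3_eta v) GE h3E g3E k00'.
  move: (v 0 0) (v 0 1) (v 0 2) => x y z.
  have /eqP : (p * y + q * z) ^+ 2 = 0.
    by have := kf y z; have := sqr_ge0 (p * y + q * z); rewrite k00'; lra.
  rewrite sqrf_eq0 => /eqP ->; rewrite -subr_ge0.
  have -> : (x - t * z) ^+ 2 * f2 y z + 2 * ((x - t * z) * (z * (l y z * 0)))
      + z ^+ 2 * (0 * l y z ^+ 2) - a^-1 * ((x - t * z) * (a * y + b * z)) ^+ 2
      = (x - t * z) ^+ 2 * (z ^+ 2 * (a * c - b ^+ 2)) / a.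
    by rewrite /f2 /quadratic2; field; rewrite lt0r_neq0.
  apply: divr_ge0 (ltW ap); apply: mulr_ge0; first exact: sqr_ge0.
  by apply: mulr_ge0; [exact: sqr_ge0 | rewrite subr_ge0].
have kp : 0 < k by rewrite lt0r kn0.
(* Completes the square in the term z^2 h3 = k (z l)^2: k G - r^2 = (x - t z)^2 (k f2 - (p y + q
   z)^2). *)
pose r v := k * (v 0 2 * (z0 * v 0 1 + - y0 * v 0 2))
   + (v 0 0 + - t * v 0 2) * (p * v 0 1 + q * v 0 2).
have rE x y z : r (row3 x y z) = k * (z * l y z) + (x - t * z) * (p * y + q * z).
  by rewrite /r /l !row3E; ring.
exists r, k^-1; split=> //.
- apply: formD; first by apply: formZ; apply: is_formS; exact: is_form_linear2.
  apply: (@formM _ _ 1 1); last exact: is_form_linear2.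
  by apply: formD; [|apply: formZ]; exact: form_coord.
(* On the plane x = t z only k z l survives in [r]; the witness there has z and l both nonzero. *)
- have [y00|yn0] := eqVneq y0 0.
    have zn0 : z0 != 0 by apply: contraTneq n0 => ->; rewrite y00 expr0n addr0 ltxx.
    exists (row3 t 1 1); rewrite rE /l y00 (_ : _ + _ = k * z0); first exact: mulf_neq0.
    by ring.
  exists (row3 (t * - y0) z0 (- y0)); rewrite rE /l (_ : _ + _ = k * (- y0 * n)).
    by apply: mulf_neq0 => //; apply: mulf_neq0 => //; rewrite oppr_eq0.
  by rewrite /n; ring.
- by rewrite invr_gt0.
move=> v; rewrite (row3_eta v) GE rE h3E g3E.
move: (v 0 0) (v 0 1) (v 0 2) => x y z; rewrite -subr_ge0.
set lhs := (X in 0 <= X).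
have -> : lhs = (x - t * z) ^+ 2 * (k * f2 y z - (p * y + q * z) ^+ 2) / k.
  by rewrite /lhs; field.
by rewrite divr_ge0 // mulr_ge0 ?sqr_ge0.
Qed.

(** With f2 positive definite, f2 G = (x f2 + f3)^2 + D. If the sextic D is positive, it exceeds e
    f2^3 and G >= e f2^2. If D vanishes at (y0, z0), then x = - f3 / f2 gives a second zero of G. *)
Lemma square_minorant_nondegenerate G : is_form 4 G -> (forall v, 0 <= G v) ->
  G (row3 1 0 0) = 0 ->
  (forall y z, 0 < y ^+ 2 + z ^+ 2 ->
    2 * G (row3 0 y z) < G (row3 1 y z) + G (row3 (-1) y z)) ->
  square_minorant 2 G.
Proof.
move=> hG G0 Ge1 Hess.
have [a [b [c [d0 [d1 [d2 [d3 [k0 [k1 [k2 [k3 [k4 GE]]]]]]]]]]]] :=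
  quartic_at_zero hG G0 Ge1.
move: GE; set f2 := quadratic2 a b c; set f3 := cubic2 d0 d1 d2 d3.
set f4 := quartic2 k0 k1 k2 k3 k4 => GE.
have f2p y z : 0 < y ^+ 2 + z ^+ 2 -> 0 < f2 y z.
  by move=> /Hess; rewrite !GE; lra.
have hf2 : is_form 2 (fun v : 'rV[R]_3 => f2 (v 0 1) (v 0 2)) by exact: is_form_quadratic2.
pose D y z := f2 y z * f4 y z - f3 y z ^+ 2.
have hD : is_form 6 (fun v : 'rV[R]_3 => D (v 0 1) (v 0 2)).
  apply: formB; last exact: (formX 2 (is_form_cubic2 _ _ _ _ _ _)).
  by apply: (@formM _ _ 2 4) => //; exact: is_form_quartic2.
have D0 y z : 0 <= D y z.
  by rewrite subr_ge0; have [|_ _] := @quadratic_ge0 _ (f2 y z) (f3 y z) (f4 y z);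
    first by move=> x; rewrite -GE.
case: (pselect (forall y z, 0 < y ^+ 2 + z ^+ 2 -> 0 < D y z)) => [pos|].
  have [//||e e0 H] := @binary_pos_bound 3 _ (fun y z => f2 y z ^+ 3) _ hD _ pos.
    exact: (formX 3 hf2).
  exists (fun v => f2 (v 0 1) (v 0 2)), e; split=> //.
    by exists (row3 0 1 0); rewrite !row3E lt0r_neq0 // f2p // expr1n expr0n addr0.
  move=> v; case: (ltP 0 (f2 (v 0 1) (v 0 2))) => [fp|fle]; last first.
    suff -> : f2 (v 0 1) (v 0 2) = 0 by rewrite expr0n mulr0.
    have n0 : ~~ (0 < v 0 1 ^+ 2 + v 0 2 ^+ 2).
      by apply/negP => /f2p; rewrite ltNge fle.
    rewrite -leNgt in n0; have := sqr_ge0 (v 0 1); have := sqr_ge0 (v 0 2) => z2 y2.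
    have /eqP : v 0 1 ^+ 2 = 0 by lra.
    have /eqP : v 0 2 ^+ 2 = 0 by lra.
    by rewrite !sqrf_eq0 => /eqP -> /eqP ->; rewrite /f2 /quadratic2; ring.
  rewrite [in leRHS](row3_eta v) GE; move: (v 0 0) (v 0 1) (v 0 2) fp => x y z fp.
  rewrite -(ler_pM2r fp) -subr_ge0.
  have -> : (x ^+ 2 * f2 y z + 2 * (x * f3 y z) + f4 y z) * f2 y z
      - e * f2 y z ^+ 2 * f2 y z = (x * f2 y z + f3 y z) ^+ 2
      + (D y z - e * f2 y z ^+ 3) by rewrite /D; ring.
  by rewrite addr_ge0 ?sqr_ge0 // subr_ge0.
move=> /existsNP[y0 /existsNP[z0 /not_implyP[n0 /negP]]]; rewrite -leNgt => Dle.
have Dz : D y0 z0 = 0 by apply/eqP; rewrite eq_le Dle D0.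
have fp := f2p _ _ n0.
have [M uM ME] := shear_unitmx (- f3 y0 z0 / f2 y0 z0) n0.
(* [M] puts the second zero on the third axis; [S] swaps the last two coordinates, bringing it to
   (0,1,0). *)
have [|S uS SE] := @shear_unitmx 0 1 0; first by rewrite expr1n expr0n addr0.
apply: (square_minorant_mulmx uM); apply: (square_minorant_mulmx uS).
have {ME SE} ME x y z : row3 x y z *m S *m M = row3 (x + - f3 y0 z0 / f2 y0 z0 * y)
    (y0 * y - z0 * z) (y0 * z + z0 * y).
  by rewrite SE ME; congr row3; ring.
apply: square_minorant_two_zeros => //.
- exact: (form_mulmx S (form_mulmx M hG)).
- by rewrite ME -[RHS]Ge1; congr (G (row3 _ _ _)); ring.
- rewrite ME; apply: (mulIf (lt0r_neq0 fp)); rewrite mul0r -[RHS]Dz.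
  rewrite (_ : row3 _ _ _ = row3 (- f3 y0 z0 / f2 y0 z0) y0 z0); last first.
    by congr row3; ring.
  by rewrite GE /D; field; rewrite lt0r_neq0.
move=> y z nyz; rewrite !ME !GE.
have : 0 < f2 (y0 * y - z0 * z) (y0 * z + z0 * y).
  apply: f2p; rewrite (_ : _ + _ = (y0 ^+ 2 + z0 ^+ 2) * (y ^+ 2 + z ^+ 2)).
    exact: mulr_gt0.
  by ring.
move: (f2 _ _) (f3 _ _) (f4 _ _) => A B C A0; rewrite -subr_gt0.
by rewrite (_ : _ - _ = 2 * A) ?mulr_gt0 //; ring.
Qed.

Lemma delta_mx_row3 : [/\ delta_mx 0 0 = row3 1 0 0 :> 'rV[R]_3,
  delta_mx 0 1 = row3 0 1 0 :> 'rV[R]_3 & delta_mx 0 2 = row3 0 0 1 :> 'rV[R]_3].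
Proof. by split; apply/rowP; apply: ord3P; rewrite mxE row3E. Qed.

(** Without zeros, compactness gives e (x^2 + y^2 + z^2)^2. At a zero, moved to (1,0,0), the x^2
    coefficient is a nonnegative binary quadratic form: either it is positive definite, or it
    vanishes in a direction that is moved to the third axis. *)
Lemma quartic_square_minorant G : is_form 4 G -> (forall v, 0 <= G v) ->
  (exists w, G w != 0) -> square_minorant 2 G.
Proof.
move=> hG G0 Gn; have [e1E _ e3E] := delta_mx_row3.
case: (pselect (forall v, v != 0 -> 0 < G v)) => [pos|].
  pose q v := v 0 0 ^+ 2 + v 0 1 ^+ 2 + v 0 2 ^+ 2.
  have hq : is_form 2 q.
    by do 2?apply: formD; apply: (formX 2 (form_coord R _)).
  have [//|e e0 H] := form_pos_bound _ hG (formX 2 hq) pos.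
  exists q, e; split=> //; exists (row3 1 0 0).
  by rewrite /q !row3E expr1n expr0n !addr0 oner_eq0.
move=> /existsNP[v /not_implyP[vn0 /negP]]; rewrite -leNgt => Gv.
have [M uM Mv] := unitmx_row 0 vn0; apply: (square_minorant_mulmx uM).
have hG' := form_mulmx M hG.
have Ge1 : G (row3 1 0 0 *m M) = 0.
  by apply/eqP; rewrite -e1E Mv eq_le Gv G0.
case: (pselect (forall y z, 0 < y ^+ 2 + z ^+ 2 -> 2 * G (row3 0 y z *m M)
    < G (row3 1 y z *m M) + G (row3 (-1) y z *m M))) => [nd|].
  exact: (square_minorant_nondegenerate hG').
move=> /existsNP[y0 /existsNP[z0 /not_implyP[n0 /negP]]]; rewrite -leNgt => Hle.
have [N uN NE] := shear_unitmx 0 n0; apply: (square_minorant_mulmx uN).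
apply: square_minorant_degenerate => //.
- exact: (form_mulmx N hG').
- case: Gn => w Gw; exists (w *m invmx M *m invmx N).
  by rewrite !mulmxKV.
- by rewrite NE -[RHS]Ge1; congr (G (row3 _ _ _ *m M)); ring.
have NE3 x : row3 x 0 1 *m N = row3 x y0 z0 by rewrite NE; congr row3; ring.
by rewrite !NE3.
Qed.

(** In coordinates where x^2 has the positive coefficient [a], completing the square leaves a
    remainder free of x; it equals [G] where [r] vanishes, so it is nonnegative. *)
Lemma quadratic_square_minorant G : is_form 2 G -> (forall v, 0 <= G v) ->
  (exists w, G w != 0) -> square_minorant 1 G.
Proof.
move=> hG G0 [w Gw]; have [e1E _ _] := delta_mx_row3.
have wn0 : w != 0.
  apply: contra_neq Gw => ->; have := form_homog hG 0 0.
  by rewrite scale0r expr0n mul0r.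
have [M uM Mw] := unitmx_row 0 wn0; apply: (square_minorant_mulmx uM).
have [a [b [c [d [e [f GE]]]]]] := form2E (form_mulmx M hG).
have ap : 0 < a.
  have := GE 1 0 0; rewrite -e1E Mw => E; rewrite lt0r.
  have <- : G w = a by rewrite E; ring.
  by rewrite Gw G0.
pose r v := a * v 0 0 + (b / 2 * v 0 1 + c / 2 * v 0 2).
exists r, a^-1; split.
- by do 2?apply: formD; apply: formZ; exact: form_coord.
- by exists (row3 1 0 0); rewrite /r !row3E !mulr0 mulr1 !addr0 lt0r_neq0.
- by rewrite invr_gt0.
move=> v; rewrite [v]row3_eta; move: (v 0 0) (v 0 1) (v 0 2) => x y z.
pose x0 := - (b / 2 * y + c / 2 * z) / a.
rewrite -subr_ge0; have := G0 (row3 x0 y z *m M).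
rewrite !GE /r !row3E /x0; congr (_ <= _).
by field; rewrite lt0r_neq0.
Qed.

Lemma form_square_minorant m G : (m <= 2)%N -> is_form m.*2 G ->
  (forall v, 0 <= G v) -> (exists w, G w != 0) -> square_minorant m G.
Proof.
case: m => [|[|[|//]]] _ hG G0 Gn.
- case: hG => c GE; case: Gn => w; rewrite GE => cn0.
  exists (fun=> 1), c; split=> [|||v]; first exact: form_const.
  + by exists 0; rewrite oner_eq0.
  + by rewrite lt0r cn0 -(GE 0) G0.
  + by rewrite GE expr1n mulr1.
- exact: quadratic_square_minorant.
- exact: quartic_square_minorant.
Qed.

Lemma form_mul_neq0 n k F G : is_form n F -> is_form k G ->
  (exists w, F w != 0) -> (exists w, G w != 0) -> exists w, F w * G w != 0.
Proof.
move=> hF hG [w Fw] Gn; apply: contrapT => H; move/eqP: Fw; apply.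
apply: (form_eq_dense hF (form0 _ _ _) hG Gn) => v Gv.
apply: contrapT => /eqP Fv; apply: H; exists v; exact: mulf_neq0.
Qed.

Lemma sextic_square_minorant D p q : is_form 6 D -> is_form 4 p -> is_form 5 q ->
  (forall v, 0 <= D v) -> (exists w, D w != 0) -> (exists w, p w != 0) ->
  (forall v, p v * D v = q v ^+ 2) -> square_minorant 3 D.
Proof.
move=> hD hp hq D0 [w Dw] [u pu] E; have [_ _ e3E] := delta_mx_row3.
have wn0 : w != 0.
  apply: contra_neq Dw => ->; have := form_homog hD 0 0.
  by rewrite scale0r expr0n mul0r.
have [M uM Mw] := unitmx_row 2 wn0; apply: (square_minorant_mulmx uM).
have hD' := form_mulmx M hD; have hp' := form_mulmx M hp.
have [d [dE td cd]] := form_dehomog hD'.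
have [p1 [pE tp _]] := form_dehomog hp'.
have [q1 [qE _ _]] := form_dehomog (form_mulmx M hq).
have pdq : p1 * d = q1 ^+ 2.
  apply/eqP; rewrite -subr_eq0; apply/eqP; apply: poly2_eq0 => s t.
  by rewrite !hornerE dE pE qE E subrr.
have p1n0 : p1 != 0.
  apply: contra_neq pu => p10.
  have := form_eq_affine hp' (form0 _ _ 4) _ (u *m invmx M).
  by rewrite mulmxKV //; apply=> s t; rewrite -pE p10 !horner0.
have [g [h [szg dgh]]] := square_quotient p1n0 pdq.
have d6 : d`_6 != 0.
  apply: contra_neq Dw => d60; move: cd.
  by rewrite d60 coef0 -e3E Mw => <-.
have [m [m2 tg th]] :=
  sextic_split td d6 (leq_trans szg (tdeg_le_size tp)) dgh.
have [G hG GE] := form_homogenize tg; have [H hH HE] := form_homogenize th.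
have DGH v : D (v *m M) = G v * H v ^+ 2.
  have hGH : is_form 6 (fun v => G v * H v ^+ 2).
    have := formM hG (formX 2 hH); rewrite (_ : (_ + _)%N = 6%N) //.
    by move: m2; lia.
  apply: (form_eq_affine hD' hGH) => s t.
  by rewrite -dE dgh !hornerE GE HE.
have DMn : G (w *m invmx M) * H (w *m invmx M) ^+ 2 != 0 by rewrite -DGH mulmxKV.
have Gn : exists v, G v != 0.
  by exists (w *m invmx M); apply: contra_neq DMn => ->; rewrite mul0r.
have Hn : exists v, H v != 0.
  by exists (w *m invmx M); apply: contra_neq DMn => ->; rewrite expr0n mulr0.
(* The sign of G is that of D wherever H != 0; density covers the zeros of H. *)
have G0 v : 0 <= G v.
  apply: (form_ge0_dense hG hH Hn) => {}v Hv.
  have H2 : 0 < H v ^+ 2 by rewrite lt0r sqr_ge0 andbT expf_neq0.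
  by rewrite -(pmulr_lge0 _ H2) -DGH.
have [r [e [hr rn e0 re]]] := form_square_minorant m2 hG G0 Gn.
exists (fun v => r v * H v), e; split=> //.
- by have := formM hr hH; rewrite subnKC // (leq_trans m2).
- exact: form_mul_neq0 hr hH rn Hn.
by move=> v; rewrite DGH exprMn mulrA ler_wpM2r // sqr_ge0.
Qed.

End SquareMinorants.

(** * Acoustic tensors *)

Section SymmetricMatrices.
Variable R : realFieldType.
Implicit Types a b c d e f u v w x y z : R.

(** The six scalars are the upper triangle, row by row, of the symmetric matrix with rows (a, b, c),
    (b, d, e), (c, e, f). The same convention holds for [det3] and for [adj3], the quadratic form of
    the adjugate. *)
Definition quad3 a b c d e f x y z := a * x ^+ 2 + d * y ^+ 2 + f * z ^+ 2
  + 2 * (b * (x * y) + c * (x * z) + e * (y * z)).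

Definition det3 a b c d e f :=
  a * (d * f - e ^+ 2) - b * (b * f - c * e) + c * (b * e - c * d).

Definition adj3 a b c d e f := quad3 (d * f - e ^+ 2) (c * e - b * f) (b * e - c * d)
  (a * f - c ^+ 2) (b * c - a * e) (a * d - b ^+ 2).

Definition psd3 a b c d e f := forall x y z, 0 <= quad3 a b c d e f x y z.

(** Two eliminations: the discriminant in x is a nonnegative quadratic form in y, z, whose own
    discriminant is [a] times the determinant. If [a = 0], then [b = c = 0] and the determinant
    vanishes. *)
Lemma det3_ge0 a b c d e f : psd3 a b c d e f -> 0 <= det3 a b c d e f.
Proof.
move=> psd.
have hc y z : [/\ 0 <= a, 0 <= d * y ^+ 2 + f * z ^+ 2 + 2 * e * (y * z) &
    (b * y + c * z) ^+ 2 <= a * (d * y ^+ 2 + f * z ^+ 2 + 2 * e * (y * z))].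
  apply: quadratic_ge0 => x; have := psd x y z; rewrite /quad3.
  by congr (_ <= _); ring.
have [a0 _ _] := hc 0 0.
have [az|an0] := eqVneq a 0.
  have z2 (t : R) : t ^+ 2 <= 0 -> t = 0.
    move=> H; apply/eqP; rewrite -sqrf_eq0.
    by have := sqr_ge0 t; rewrite eq_le H => ->.
  have b0 : b = 0.
    by have [_ _] := hc 1 0; rewrite az mul0r mulr1 mulr0 addr0; exact: z2.
  have c0 : c = 0.
    by have [_ _] := hc 0 1; rewrite az mul0r mulr1 mulr0 add0r; exact: z2.
  by rewrite /det3 az b0 c0 !mul0r subr0 addr0.
have ap : 0 < a by rewrite lt0r an0.
have [|_ _ disc] := @quadratic_ge0 _ (a * d - b ^+ 2) (a * e - b * c) (a * f - c ^+ 2).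
  move=> y; have [_ _] := hc y 1; rewrite -subr_ge0.
  by congr (_ <= _); ring.
rewrite -(pmulr_rge0 _ ap); move: disc; rewrite -subr_ge0 /det3.
by congr (_ <= _); ring.
Qed.

Lemma det3_rank1_update a b c d e f t u v w :
  det3 (a + t * u ^+ 2) (b + t * (u * v)) (c + t * (u * w)) (d + t * v ^+ 2)
    (e + t * (v * w)) (f + t * w ^+ 2) =
  det3 a b c d e f + t * adj3 a b c d e f u v w.
Proof. by rewrite /adj3 /det3 /quad3; ring. Qed.

(** Adding t u u^T with t >= 0 preserves semidefiniteness, and the determinant is affine in t with
    slope u^T adj u; a negative slope would make it negative for large t. *)
Lemma adj3_ge0 a b c d e f : psd3 a b c d e f ->
  forall u v w, 0 <= adj3 a b c d e f u v w.
Proof.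
move=> psd u v w; set A := adj3 _ _ _ _ _ _ _ _ _.
have D0 := det3_ge0 psd; set D := det3 _ _ _ _ _ _ in D0.
have H t : 0 <= t -> 0 <= D + t * A.
  move=> t0; rewrite -det3_rank1_update; apply: det3_ge0 => x y z.
  have -> : quad3 (a + t * u ^+ 2) (b + t * (u * v)) (c + t * (u * w)) (d + t * v ^+ 2)
      (e + t * (v * w)) (f + t * w ^+ 2) x y z
    = quad3 a b c d e f x y z + t * (u * x + v * y + w * z) ^+ 2.
    by rewrite /quad3; ring.
  by rewrite addr_ge0 ?psd // mulr_ge0 // sqr_ge0.
rewrite leNgt; apply/negP => A0.
have t0 : 0 <= (D + 1) / - A by rewrite divr_ge0 //; lra.
have := H _ t0.
have -> : D + (D + 1) / - A * A = -1 by field; lra.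
lra.
Qed.

(** The adjugate is semidefinite, so by Cauchy-Schwarz an isotropic vector lies in its kernel;
    multiplying by the matrix turns adj u = 0 into det u = 0. *)
Lemma adj3_isotropic a b c d e f u v w : psd3 a b c d e f ->
  adj3 a b c d e f u v w = 0 ->
  [/\ det3 a b c d e f * u = 0, det3 a b c d e f * v = 0 & det3 a b c d e f * w = 0].
Proof.
move=> psd A0; have adj0 := adj3_ge0 psd.
have CS x y z : (d * f - e ^+ 2) * (u * x) + (a * f - c ^+ 2) * (v * y)
   + (a * d - b ^+ 2) * (w * z) + (c * e - b * f) * (u * y + v * x)
   + (b * e - c * d) * (u * z + w * x) + (b * c - a * e) * (v * z + w * y) = 0.
  set L := (X in X = 0).
  have [|_ _] := @quadratic_ge0 _ (adj3 a b c d e f u v w) L (adj3 a b c d e f x y z).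
    move=> t; have := adj0 (t * u + x) (t * v + y) (t * w + z).
    by rewrite /L /adj3 /quad3; congr (_ <= _); ring.
  rewrite A0 mul0r => L0; apply/eqP; rewrite -sqrf_eq0.
  by have := sqr_ge0 L; rewrite eq_le L0 => ->.
(* Pairing adj u with each row of the matrix gives the components of det u. *)
by split; [rewrite -(CS a b c) | rewrite -(CS b d e) | rewrite -(CS c e f)];
  rewrite /det3; ring.
Qed.

Lemma adj3_mul a b c d e f u v w : adj3 a b c d e f u v w =
  u * ((d * f - e ^+ 2) * u + (c * e - b * f) * v + (b * e - c * d) * w) +
  v * ((c * e - b * f) * u + (a * f - c ^+ 2) * v + (b * c - a * e) * w) +
  w * ((b * e - c * d) * u + (b * c - a * e) * v + (a * d - b ^+ 2) * w).
Proof. by rewrite /adj3 /quad3; ring. Qed.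

(* The cofactor matrix of a singular symmetric matrix has rank at most one. *)
Lemma adj3_rank1 a b c d e f u v w : det3 a b c d e f = 0 ->
  [/\ (d * f - e ^+ 2) * adj3 a b c d e f u v w =
      ((d * f - e ^+ 2) * u + (c * e - b * f) * v + (b * e - c * d) * w) ^+ 2,
     (a * f - c ^+ 2) * adj3 a b c d e f u v w =
      ((c * e - b * f) * u + (a * f - c ^+ 2) * v + (b * c - a * e) * w) ^+ 2 &
     (a * d - b ^+ 2) * adj3 a b c d e f u v w =
      ((b * e - c * d) * u + (b * c - a * e) * v + (a * d - b ^+ 2) * w) ^+ 2].
Proof.
move=> D0; split; apply/eqP; rewrite -subr_eq0; apply/eqP.
(* The 2x2 minors of the adjugate are the determinant times entries of the matrix, so the difference
   is a multiple of the determinant. *)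
- rewrite -[RHS](mul0r (f * v ^+ 2 - 2 * e * (v * w) + d * w ^+ 2)) -D0.
  by rewrite /adj3 /quad3 /det3; ring.
- rewrite -[RHS](mul0r (f * u ^+ 2 - 2 * c * (u * w) + a * w ^+ 2)) -D0.
  by rewrite /adj3 /quad3 /det3; ring.
- rewrite -[RHS](mul0r (d * u ^+ 2 - 2 * b * (u * v) + a * v ^+ 2)) -D0.
  by rewrite /adj3 /quad3 /det3; ring.
Qed.

Lemma det_mx3 (A : 'M[R]_3) : A^T = A ->
  \det A = det3 (A 0 0) (A 0 1) (A 0 2) (A 1 1) (A 1 2) (A 2 2).
Proof.
move=> sA; pose a (i j : nat) := A (inord i) (inord j).
have aE i j : A i j = a i j by rewrite /a !inord_val.
have s i j : A i j = A j i by rewrite -{1}sA mxE.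
rewrite (expand_det_row _ 0) sum3 /cofactor !(expand_det_row _ ord0).
rewrite !big_ord_recl !big_ord0 /cofactor !det_mx11 !mxE.
have [s01 s02 s12] := And3 (s 1 0) (s 2 0) (s 2 1).
move: s01 s02 s12; rewrite !aE /= /bump /= => s01 s02 s12.
rewrite /det3; ring: s01 s02 s12.
Qed.
End SymmetricMatrices.

(** * Consequences of extremality of a polynomial *)

Section Extremality.
Variables (R : realType) (n k : nat).
Implicit Types (P : mpoly n R) (F : 'rV[R]_n -> R).

Lemma meval_row P (v : 'I_n -> R) : meval v P = meval ((\row_i v i : 'rV_n) 0) P.
Proof. by apply: meval_eq => i; rewrite mxE. Qed.

Lemma mpoly_eq_row P Q : (forall v : 'rV[R]_n, meval (v 0) P = meval (v 0) Q) -> P = Q.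
Proof.
move=> E; apply/eqP; rewrite -subr_eq0; apply/eqP; apply: meval_eq0 => v.
by rewrite mevalB !(meval_row _ v) E subrr.
Qed.

(** Extremality makes F and P - F dependent: a F + b (P - F) = 0. Here a = b would give a P = 0, so
    one can solve for F. *)
Lemma extremal_poly_minorant P F : extremal_poly P -> P != 0 -> is_form k F ->
  (forall v, 0 <= F v) -> (forall v, F v <= meval (v 0) P) ->
  exists c, forall v, F v = c * meval (v 0) P.
Proof.
move=> [_ _ ext] Pn0 hF F0 FP; have [Q QE] := form_mpoly hF.
have [a [b [E nab]]] : exists a b, a *: Q + b *: (P - Q) = 0 /\ ~ (a = 0 /\ b = 0).
  apply: contrapT => H; apply: ext; exists Q, (P - Q); split.
  - by move=> v; rewrite meval_row QE.
  - by move=> v; rewrite mevalB !(meval_row _ v) QE subr_ge0.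
  - by rewrite addrC subrK.
  - by move=> a b E; apply: contrapT => nab; apply: H; exists a, b.
have abn0 : a - b != 0.
  apply/eqP => /eqP; rewrite subr_eq0 => /eqP ab; apply: nab.
  move: E; rewrite ab -scalerDr addrC subrK => /eqP.
  by rewrite scaler_eq0 (negPf Pn0) orbF => /eqP.
exists (- b / (a - b)) => v; have := congr1 (meval (v 0)) E.
rewrite mevalD !mevalZ mevalB meval0 QE => H.
apply: (mulfI abn0); rewrite mulrA mulrCA divff // mulr1; lra.
Qed.

End Extremality.

(** The minorant satisfies e r^2 = c P with c > 0, so P is the square of sqrt(e / c) r. *)
Lemma extremal_poly_square (R : realType) k (P : mpoly 3 R) :
  extremal_poly P -> P != 0 ->
  square_minorant k (fun v => meval (v 0) P) -> perfect_square P.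
Proof.
move=> ext Pn0 [r [e [hr [w rw] e0 H]]].
have er0 v : 0 <= e * r v ^+ 2 by rewrite mulr_ge0 ?sqr_ge0 // ltW.
have [c cE] := extremal_poly_minorant ext Pn0 (formZ e (formX 2 hr)) er0 H.
have [Q QE] := form_mpoly hr.
have Pw : 0 <= meval (w 0) P by apply: le_trans (er0 w) (H w).
have cP : 0 < c * meval (w 0) P.
  by rewrite -cE mulr_gt0 // lt0r sqr_ge0 andbT expf_neq0.
have c0 : 0 < c.
  by rewrite ltNge; apply/negP => cle; move: cP; rewrite ltNge mulr_le0_ge0.
exists (Num.sqrt (e / c) *: Q); apply: mpoly_eq_row => v.
rewrite exprZn mevalZ (expr2 Q) mevalM -expr2 sqr_sqrtr; last by rewrite divr_ge0 // ltW.
by rewrite QE mulrAC cE mulrAC divff ?mul1r // lt0r_neq0.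
Qed.

Section FormMinors.
Variables (R : realType) (m : nat).
Implicit Types a b c d : 'rV[R]_m -> R.

Lemma is_form_minor a b c d : is_form 2 a -> is_form 2 b -> is_form 2 c ->
  is_form 2 d -> is_form 4 (fun v => a v * b v - c v * d v).
Proof. by move=> ha hb hc hd; apply: formB; apply: (@formM _ _ 2 2). Qed.

Lemma is_form_sym_minor a b c : is_form 2 a -> is_form 2 b -> is_form 2 c ->
  is_form 4 (fun v => a v * b v - c v ^+ 2).
Proof.
by move=> ha hb hc; apply: formB; [apply: (@formM _ _ 2 2) | apply: (formX 2 hc)].
Qed.

Lemma is_form_quad3 k (a b c d e f x y z : 'rV[R]_m -> R) :
  is_form k a -> is_form k b -> is_form k c -> is_form k d -> is_form k e ->
  is_form k f -> is_form 1 x -> is_form 1 y -> is_form 1 z ->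
  is_form (k + 2)
    (fun v => quad3 (a v) (b v) (c v) (d v) (e v) (f v) (x v) (y v) (z v)).
Proof.
move=> ha hb hc hd he hf hx hy hz.
have h2 (g p q : 'rV[R]_m -> R) : is_form k g -> is_form 1 p -> is_form 1 q ->
    is_form (k + 2) (fun v => g v * (p v * q v)).
  by move=> hg hp hq; apply: formM => //; apply: (@formM _ _ 1 1).
by do !(apply: formD); rewrite ?expr2; first exact: h2;
  [exact: h2 | exact: h2 | apply: formZ; do !apply: formD; exact: h2].
Qed.

Lemma is_form_det3 (a b c d e f : 'rV[R]_m -> R) :
  is_form 2 a -> is_form 2 b -> is_form 2 c -> is_form 2 d -> is_form 2 e ->
  is_form 2 f -> is_form 6 (fun v => det3 (a v) (b v) (c v) (d v) (e v) (f v)).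
Proof.
move=> ha hb hc hd he hf; apply: formD; first apply: formB.
- by apply: (@formM _ _ 2 4) => //; exact: is_form_sym_minor.
- by apply: (@formM _ _ 2 4) => //; exact: is_form_minor.
- by apply: (@formM _ _ 2 4) => //; exact: is_form_minor.
Qed.

Lemma is_form_adj3 (a b c d e f x y z : 'rV[R]_m -> R) :
  is_form 2 a -> is_form 2 b -> is_form 2 c -> is_form 2 d -> is_form 2 e ->
  is_form 2 f -> is_form 1 x -> is_form 1 y -> is_form 1 z ->
  is_form 6 (fun v => adj3 (a v) (b v) (c v) (d v) (e v) (f v) (x v) (y v) (z v)).
Proof.
by move=> *; apply: (@is_form_quad3 4) => //;
  (exact: is_form_minor || exact: is_form_sym_minor).
Qed.

End FormMinors.

Theorem theorem2p5 (R : realType) (C : 'I_3 -> 'I_3 -> 'I_3 -> 'I_3 -> R)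
  (T : 'M[mpoly 3 R]_3)
  (hf : quasiconvex (quad_form C))
  (hT : is_y_matrix (quad_form C) T)
  (hext : extremal_poly (\det T))
  (hsq : ~ perfect_square (\det T)) :
  extremal_form (quad_form C).
Proof.
split=> // -[B [Bn0 hB]]; have [sT homT fT] := hT.
have Pn0 : \det T != 0.
  by apply/eqP => D0; apply: hsq; exists 0; rewrite expr0n.
pose t i k (y : 'rV[R]_3) := meval (y 0) (T i k).
have ht i k : is_form 2 (t i k) by apply: mpoly_form; exact: homT.
have ts i k y : t i k y = t k i y by rewrite /t -{1}sT mxE.
pose D y := det3 (t 0 0 y) (t 0 1 y) (t 0 2 y) (t 1 1 y) (t 1 2 y) (t 2 2 y).
have DE (y : 'rV[R]_3) : meval (y 0) (\det T) = D y.
  rewrite -det_map_mx det_mx3; first by rewrite !mxE.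
  by rewrite map_trmx sT.
pose Q y := quad3 (t 0 0 y) (t 0 1 y) (t 0 2 y) (t 1 1 y) (t 1 2 y) (t 2 2 y).
have QE (x y : 'rV[R]_3) : quad_form C (tens x y) = Q y (x 0 0) (x 0 1) (x 0 2).
  rewrite fT mxE sum3 !mxE !sum3 !mxE -!/(t _ _ y).
  by rewrite (ts 1 0) (ts 2 0) (ts 2 1) /Q /quad3; ring.
pose be i (y : 'rV[R]_3) := \sum_j B i j * y 0 j.
have hbe i : is_form 1 (be i).
  by apply: form_sum => j; apply: formZ; exact: form_coord.
have BE (x y : 'rV[R]_3) : rank_one_form B (tens x y) =
    (x 0 0 * be 0 y + x 0 1 * be 1 y + x 0 2 * be 2 y) ^+ 2.
  rewrite rank_one_form_tens; congr (_ ^+ 2); rewrite -mulmxA mxE sum3.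
  by congr (_ * _ + _ * _ + _ * _); rewrite mxE; apply: eq_bigr => j _; rewrite mxE.
have psdT y : psd3 (t 0 0 y) (t 0 1 y) (t 0 2 y) (t 1 1 y) (t 1 2 y) (t 2 2 y).
  by move=> x0 x1 x2; have := hf (row3 x0 x1 x2) y; rewrite QE !row3E.
(* T - b b^T is written as a rank-one update with t = -1, so that [det3_rank1_update] yields D - E
   as its determinant. *)
have psdTB y : psd3 (t 0 0 y + -1 * be 0 y ^+ 2)
    (t 0 1 y + -1 * (be 0 y * be 1 y)) (t 0 2 y + -1 * (be 0 y * be 2 y))
    (t 1 1 y + -1 * be 1 y ^+ 2) (t 1 2 y + -1 * (be 1 y * be 2 y))
    (t 2 2 y + -1 * be 2 y ^+ 2).
  move=> x0 x1 x2; have := hB (row3 x0 x1 x2) y; rewrite QE BE !row3E /Q /quad3.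
  by congr (_ <= _); ring.
pose E y := adj3 (t 0 0 y) (t 0 1 y) (t 0 2 y) (t 1 1 y) (t 1 2 y) (t 2 2 y)
  (be 0 y) (be 1 y) (be 2 y).
have E0 y : 0 <= E y by exact: adj3_ge0.
have ED y : E y <= D y.
  have := det3_ge0 (psdTB y); rewrite det3_rank1_update mulN1r subr_ge0.
  exact.
have hE : is_form 6 E by exact: is_form_adj3.
have hD : is_form 6 D by exact: is_form_det3.
have Dn : exists w, D w != 0.
  apply: contrapT => H; case/eqP: Pn0; apply: mpoly_eq_row => v.
  rewrite DE meval0; apply: contrapT => Dv; apply: H; exists v; exact/eqP.
have D0 y : 0 <= D y by apply: le_trans (E0 y) (ED y).
have [lam lamE] : exists lam, forall y, E y = lam * D y.
  have [|lam lamE] := extremal_poly_minorant hext Pn0 hE E0.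
    by move=> y; rewrite DE.
  by exists lam => y; rewrite lamE DE.
have [lam0|lamn0] := eqVneq lam 0.
  have be0 i y : be i y = 0.
    apply: (form_eq_dense (hbe i) (form0 _ _ _) hD Dn) => {}y Dy.
    apply: (mulfI Dy); rewrite mulr0.
    have [|H0 H1 H2] := adj3_isotropic (psdT y) (u := be 0 y) (v := be 1 y) (w := be 2 y).
      by have := lamE y; rewrite lam0 mul0r.
    by move: i; apply: ord3P.
  case/eqP: Bn0; apply/matrixP => i j; rewrite mxE -[RHS](be0 i (delta_mx 0 j)).
  rewrite /be (bigD1 j) //= mxE !eqxx mulr1 big1 ?addr0 // => l /negPf lj.
  by rewrite mxE lj andbF mulr0.
pose s i k y := lam * t i k y + -1 * (be i y * be k y).
have hs i k : is_form 2 (s i k).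
  by apply: formD; apply: formZ => //; apply: (@formM _ _ 1 1).
pose dS y := det3 (s 0 0 y) (s 0 1 y) (s 0 2 y) (s 1 1 y) (s 1 2 y) (s 2 2 y).
pose aS y := adj3 (s 0 0 y) (s 0 1 y) (s 0 2 y) (s 1 1 y) (s 1 2 y) (s 2 2 y)
  (be 0 y) (be 1 y) (be 2 y).
have dS0 y : dS y = 0.
  rewrite (_ : dS y = lam ^+ 2 * (lam * D y - E y)); last first.
    by rewrite /dS /D /E /s /adj3 /det3 /quad3; ring.
  by rewrite lamE subrr mulr0.
(* Adding [dS], which is zero, turns the left side into det(S + b b^T) = det(lam T). *)
have aSE y : aS y = lam ^+ 3 * D y.
  rewrite -[LHS]add0r -(dS0 y) /aS /dS /D /s /adj3 /det3 /quad3; ring.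
have rk y := adj3_rank1 (be 0 y) (be 1 y) (be 2 y) (dS0 y).
(* To be applied to the three diagonal cofactors of S: a nonzero one would make det T a perfect
   square. *)
have fin p q : is_form 4 p -> is_form 5 q -> (forall y, p y * aS y = q y ^+ 2) ->
    p =1 (fun=> 0).
  move=> hp hq pq; apply: contrapT => /existsNP[w /eqP pw]; apply: hsq.
  apply: (@extremal_poly_square _ 3) => //.
  rewrite (_ : (fun v => _) = D); last by apply: funext => v; rewrite DE.
  apply: (@sextic_square_minorant _ D (fun v => lam ^+ 3 * p v) q) => //.
  - exact: formZ.
  - by exists w; rewrite mulf_neq0 // expf_neq0.
  - by move=> v; rewrite -pq aSE mulrCA mulrA.
have hq (a b c : 'rV[R]_3 -> R) : is_form 4 a -> is_form 4 b -> is_form 4 c ->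
    is_form 5 (fun y => a y * be 0 y + b y * be 1 y + c y * be 2 y).
  by move=> ha hb hc; do 2?apply: formD; apply: (@formM _ _ 4 1).
have h00 : is_form 4 (fun y => s 1 1 y * s 2 2 y - s 1 2 y ^+ 2).
  by exact: is_form_sym_minor.
have h11 : is_form 4 (fun y => s 0 0 y * s 2 2 y - s 0 2 y ^+ 2).
  by exact: is_form_sym_minor.
have h22 : is_form 4 (fun y => s 0 0 y * s 1 1 y - s 0 1 y ^+ 2).
  by exact: is_form_sym_minor.
have h01 : is_form 4 (fun y => s 0 2 y * s 1 2 y - s 0 1 y * s 2 2 y).
  by exact: is_form_minor.
have h02 : is_form 4 (fun y => s 0 1 y * s 1 2 y - s 0 2 y * s 1 1 y).
  by exact: is_form_minor.
have h12 : is_form 4 (fun y => s 0 1 y * s 0 2 y - s 0 0 y * s 1 2 y).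
  by exact: is_form_minor.
have p0 := fin _ _ h00 (hq _ _ _ h00 h01 h02)
  (fun y => let: And3 r _ _ := rk y in r).
have p1 := fin _ _ h11 (hq _ _ _ h01 h11 h12)
  (fun y => let: And3 _ r _ := rk y in r).
have p2 := fin _ _ h22 (hq _ _ _ h02 h12 h22)
  (fun y => let: And3 _ _ r := rk y in r).
(* With zero diagonal cofactors, [adj3_rank1] forces adj(S) b = 0, so [aS] vanishes and with it D,
   even at the point [w] where D is nonzero. *)
case: Dn => w /eqP; apply; apply: (mulfI (expf_neq0 3 lamn0)); rewrite mulr0 -aSE.
have [] := rk w; rewrite (p0 w) (p1 w) (p2 w) !mul0r.
move=> /esym/eqP; rewrite sqrf_eq0 => /eqP q0.
move=> /esym/eqP; rewrite sqrf_eq0 => /eqP q1 /esym/eqP; rewrite sqrf_eq0 => /eqP q2.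
by rewrite /aS adj3_mul (p0 w) (p1 w) (p2 w) !mul0r q0 q1 q2 !mulr0 !addr0.
Qed.
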